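(* Let $0<\alpha<n$, $1\le p<n/\alpha$, $1/q=1/p-\alpha/n$, and let $s$ satisfy $1\le s<p$ if $1<p<n/\alpha$ and $s=1$ if $p=1$. Let $w_1,w_2$ be weights on $\mathbb{R}^n$ with $(w_1^s,w_2^s)\in A_{p/s,q/s}$ and $w_2^s\in A_{p/s,q/s}$. Let $S_\alpha$ be a sublinear operator satisfying, with a constant $C$ independent of $f$, $a$, $r$, $$\sup_{x\in B(a,r)}\left|S_\alpha\left(f\cdot\mathcal{X}_{B(a,2r)^c}\right)(x)\right|\le C\sum_{k=1}^\infty(2^{k+1}r)^{-\frac ns+\alpha}\left(\int_{B(a,2^{k+1}r)}|f(y)|^s\,dy\right)^{1/s},\quad (a,r)\in\mathbb{R}^n\times\mathbb{R}^+ .$$ Suppose that two positive functions $\psi_1,\psi_2$ on $\mathbb{R}^n\times\mathbb{R}^+$ satisfy $$\sup_{(a,r)\in\mathbb{R}^n\times\mathbb{R}^+}\frac1{\psi_2(a,r)}\int_r^\infty\frac{\inf_{t\le l<\infty}\psi_1(a,l)\,w_1^p(B(a,l))^{1/p}}{w_2^q(B(a,t))^{1/q}}\frac{dt}t<\infty .$$ Then: (i) if $1<p<n/\alpha$ and $S_\alpha$ is bounded from $L^{p,w_1^p}$ to $L^{q,w_2^q}$, then $S_\alpha$ is bounded from $\mathcal{M}^{p,w_1^p}_{\psi_1}$ to $\mathcal{M}^{q,w_2^q}_{\psi_2}$; (ii) if $p=1$ and $S_\alpha$ is bounded from $L^{1,w_1}$ to $WL^{q,w_2^q}$, then $S_\alpha$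 is bounded from $\mathcal{M}^{1,w_1}_{\psi_1}$ to $W\mathcal{M}^{q,w_2^q}_{\psi_2}$.
   Context: Notation: $\mathbb{R}^+=(0,\infty)$; $B(a,r)$ is the open ball in $\mathbb{R}^n$; $\mathcal{X}_E$ is the indicator function of $E$ and $E^c$ its complement. A weight is a nonnegative locally integrable function on $\mathbb{R}^n$ with values in $(0,\infty)$ a.e.; $w(E)=\int_E w(x)\,dx$ and $w^p(E)=\int_E w(x)^p\,dx$. Weight classes: for $1<p<q<\infty$ and $1/p+1/p'=1$, a pair $(w_1,w_2)$ belongs to $A_{p,q}$ if there is $C>0$ with $\left(\frac1{|B|}\int_B w_2^q\right)^{1/q}\left(\frac1{|B|}\int_B w_1^{-p'}\right)^{1/p'}\le C$ for all balls $B$; for $p=1<q$, $(w_1,w_2)\in A_{1,q}$ if $\left(\frac1{|B|}\int_B w_2^q\right)^{1/q}\|w_1^{-1}\|_{L^\infty(B)}\le C$ for all balls $B$. A single weight $w$ is in $A_{p,q}$ if $(w,w)\in A_{p,q}$. Spaces: for a weight $w$, $1\le p<\infty$ and measurable $E\subseteq\mathbb{R}^n$, $\|f\|_{L^{p,w}(E)}=\left(\int_E|f|^pw\right)^{1/p}$ and $\|f\|_{WL^{p,w}(E)}=\sup_{\gamma>0}\gamma\,w(\{x\in E:|f(x)|>\gamma\})^{1/p}$; $L^{p,w}$, $WL^{p,w}$ denote the case $E=\mathbb{R}^n$. For positive $\psi$ on $\mathbb{R}^n\times\mathbb{R}^+$, the generalized weighted Morrey space $\mathcal{M}^{p,w}_\psi$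 and weak Morrey space $W\mathcal{M}^{p,w}_\psi$ consist of the measurable $f$ for which respectively $\|f\|_{\mathcal{M}^{p,w}_\psi}=\sup_{a,r}\frac{1}{\psi(a,r)}w(B(a,r))^{-1/p}\|f\|_{L^{p,w}(B(a,r))}$ and $\|f\|_{W\mathcal{M}^{p,w}_\psi}=\sup_{a,r}\frac{1}{\psi(a,r)}w(B(a,r))^{-1/p}\|f\|_{WL^{p,w}(B(a,r))}$ is finite. An operator $N$ is bounded from $X$ to $Y$ if there is $C>0$ with $\|Nf\|_Y\le C\|f\|_X$ for all $f\in X$. *)

(* Defs.v *)
From HB Require Import structures.
From mathcomp Require Import all_boot all_order all_algebra.
From mathcomp Require Import all_classical all_reals all_analysis.
From mathcomp Require Import measurable_realfun ess_sup_inf.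

Set Implicit Arguments.
Unset Strict Implicit.
Unset Printing Implicit Defensive.

Import Order.TTheory GRing.Theory Num.Theory.
Import numFieldNormedType.Exports.

Local Open Scope classical_set_scope.
Local Open Scope ring_scope.
Local Open Scope ereal_scope.

(* Product measure of the one-dimensional Lebesgue measure with a measure m on
   R^n, transported to (n+1)-tuples. *)
Section cons_measure.
Context {R : realType} {n : nat}.
Variable m : {sigma_finite_measure set (n.-tuple (measurableTypeR R)) -> \bar R}.

Definition tcons (z : measurableTypeR R * n.-tuple (measurableTypeR R)) :
  n.+1.-tuple (measurableTypeR R) := [tuple of z.1 :: z.2].

Lemma measurable_tcons : measurable_fun [set: _] tcons.
Proof. exact: measurable_cons. Qed.

Definition cons_measure : set (n.+1.-tuple (measurableTypeR R)) -> \bar R :=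
  pushforward ((@lebesgue_measure R) \x m) tcons.

Let m_set0 : cons_measure set0 = 0.
Proof. by rewrite /cons_measure /pushforward preimage_set0 measure0. Qed.

Let m_ge0 A : 0 <= cons_measure A.
Proof. exact: (measure_ge0 ((@lebesgue_measure R) \x m)). Qed.

Let m_sigma_additive : semi_sigma_additive cons_measure.
Proof.
rewrite /cons_measure => F mF tF mUF; rewrite /pushforward preimage_bigcup.
apply: measure_semi_sigma_additive.
- by move=> k; rewrite -[X in measurable X]setTI; exact: measurable_tcons.
- apply/trivIsetP => /= i j _ _ ij; rewrite -preimage_setI.
  by move/trivIsetP : tF => /(_ _ _ _ _ ij) ->//; rewrite preimage_set0.
- by rewrite -preimage_bigcup -[X in measurable X]setTI; exact: measurable_tcons.
Qed.

HB.instance Definition _ := isMeasure.Build _ _ _ cons_measure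
  m_set0 m_ge0 m_sigma_additive.

Let tuncons (x : n.+1.-tuple (measurableTypeR R)) :
  measurableTypeR R * n.-tuple (measurableTypeR R) :=
  (thead x, [tuple of behead x]).

Let measurable_tuncons : measurable_fun [set: _] tuncons.
Proof.
apply: measurable_fun_pair; first exact: measurable_tnth.
exact: measurable_behead.
Qed.

Let tconsK z : tuncons (tcons z) = z.
Proof. by case: z => x t; congr pair; exact: val_inj. Qed.

Let m_sigma_finite : sigma_finite setT cons_measure.
Proof.
have [F TF Foo] : sigma_finite setT ((@lebesgue_measure R) \x m).
  exact: lebesgue_integral_fubini.product_measure_sigma_finite_subproof.
exists (fun k => tuncons @^-1` F k).
  by rewrite -preimage_bigcup -TF preimage_setT.
move=> k; have [mF Fk] := Foo k; split.
  by rewrite -[X in measurable X]setTI; exact: measurable_tuncons.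
rewrite /cons_measure /pushforward -comp_preimage.
rewrite (_ : tuncons \o tcons = id) ?preimage_id//.
by apply/funext => z; exact: tconsK.
Qed.

HB.instance Definition _ := Measure_isSigmaFinite.Build _ _ _ cons_measure
  m_sigma_finite.

End cons_measure.

(* Lebesgue measure on the Borel sets of R^n; for n = 0 the space is a point,
   of mass 1. *)
Fixpoint borel_lebesgue (R : realType) (n : nat) :
    {sigma_finite_measure set (n.-tuple (measurableTypeR R)) -> \bar R} :=
  match n with
  | 0%N => \d_([tuple] : 0.-tuple (measurableTypeR R))
  | k.+1 => cons_measure (borel_lebesgue R k)
  end.

(* R^n with the sigma-algebra of Lebesgue measurable sets: the carrier is
   n.-tuple R. *)
Definition Rn (R : realType) (n : nat) :=
  caratheodory_type (borel_lebesgue R n)^*%mu.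

Definition leb (R : realType) (n : nat) : {measure set (Rn R n) -> \bar R} :=
  @completed_measure_extension _ _ R (borel_lebesgue R n).

Section weighted_spaces.
Context {R : realType} {n : nat}.
Local Notation T := (Rn R n).
Local Notation mu := (leb R n).

Definition coord (x : T) (i : 'I_n) : R :=
  tnth (x : n.-tuple (measurableTypeR R)) i.

Definition Ball (a : T) (r : R) : set T :=
  [set x | (Num.sqrt (\sum_(i < n) (coord x i - coord a i) ^+ 2) < r)%R].

Definition wmeas (w : T -> R) (E : set T) : \bar R := \int[mu]_(x in E) (w x)%:E.

Definition wpow (w : T -> R) (p : R) : T -> R := fun x => (w x `^ p)%R.

(* Local integrability is integrability on every ball. *)
Definition weight (w : T -> R) : Prop :=
  [/\ measurable_fun setT w,
      forall x, (0 <= w x)%R,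
      {ae mu, forall x, (0 < w x)%R} &
      forall a r, (0 < r)%R -> wmeas w (Ball a r) < +oo].

Definition average (E : set T) (g : T -> R) : \bar R :=
  (mu E)^-1 * \int[mu]_(x in E) (g x)%:E.

Definition Linfty_norm (E : set T) (g : T -> R) : \bar R :=
  'N[mu]_(+oo)[(EFin \o g) \_ E].

(* In the second branch the exponent 1 - 1/p is 1/p'. *)
Definition Apq (p q : R) (w1 w2 : T -> R) : Prop :=
  exists C : R, (0 < C)%R /\ forall a r, (0 < r)%R ->
    average (Ball a r) (wpow w2 q) `^ q^-1 *
    (if p == 1%R then Linfty_norm (Ball a r) (fun x => (w1 x)^-1)%R
     else let p' := ((1 - p^-1)^-1)%R in
          average (Ball a r) (wpow w1 (- p')) `^ p'^-1) <= C%:E.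

Definition Lnrm (p : R) (w : T -> R) (E : set T) (f : T -> \bar R) : \bar R :=
  (\int[mu]_(x in E) (`|f x| `^ p * (w x)%:E)) `^ p^-1.

Definition WLnrm (p : R) (w : T -> R) (E : set T) (f : T -> \bar R) : \bar R :=
  ereal_sup [set c%:E * wmeas w (E `&` [set x | c%:E < `|f x|]) `^ p^-1
            | c in [set c : R | (0 < c)%R]].

Definition morrey_nrm (p : R) (w : T -> R) (psi : T -> R -> R)
    (f : T -> \bar R) : \bar R :=
  ereal_sup [set (psi z.1 z.2)^-1%:E * (wmeas w (Ball z.1 z.2) `^ p^-1)^-1
                 * Lnrm p w (Ball z.1 z.2) f
            | z in [set z : T * R | (0 < z.2)%R]].

Definition weak_morrey_nrm (p : R) (w : T -> R) (psi : T -> R -> R)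
    (f : T -> \bar R) : \bar R :=
  ereal_sup [set (psi z.1 z.2)^-1%:E * (wmeas w (Ball z.1 z.2) `^ p^-1)^-1
                 * WLnrm p w (Ball z.1 z.2) f
            | z in [set z : T * R | (0 < z.2)%R]].

Definition space (N : (T -> \bar R) -> \bar R) : set (T -> \bar R) :=
  [set f : T -> \bar R | measurable_fun setT f /\ N f < +oo].

(* An operator takes a real-valued function to an extended real-valued one. The
   value +oo is also meant for the points where an operator such as the
   fractional integral is undefined, so that operators are total. *)
Definition operator := (T -> R) -> (T -> \bar R).

Definition sublinear (S : operator) : Prop :=
  [/\ forall f : T -> R, measurable_fun setT f -> measurable_fun setT (S f),
      forall f g : T -> R, measurable_fun setT f -> measurable_fun setT g ->
        {ae mu, forall x, `|S (f \+ g)%R x| <= `|S f x| + `|S g x|} &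
      forall (c : R) (f : T -> R), measurable_fun setT f ->
        {ae mu, forall x, `|S (fun y => c * f y)%R x| = `|c|%:E * `|S f x|}].

Definition bounded_op (S : operator) (NX NY : (T -> \bar R) -> \bar R) : Prop :=
  exists C : R, (0 < C)%R /\ forall f : T -> R, space NX (EFin \o f) ->
    space NY (S f) /\ NY (S f) <= C%:E * NX (EFin \o f).

Definition size_condition (alpha s : R) (S : operator) : Prop :=
  exists C : R, (0 < C)%R /\
  forall (f : T -> R) a r, measurable_fun setT f -> (0 < r)%R ->
    ereal_sup [set `|S (f \* \1_(~` Ball a (2 * r)))%R x| | x in Ball a r] <=
    C%:E * \sum_(1 <= k <oo)
      (((2 ^+ k.+1 * r) `^ (- (n%:R / s) + alpha))%R%:E *
       (\int[mu]_(y in Ball a (2 ^+ k.+1 * r)%R) (`|f y| `^ s)%R%:E) `^ s^-1).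

Definition psi_condition (p q : R) (w1 w2 : T -> R)
    (psi1 psi2 : T -> R -> R) : Prop :=
  ereal_sup
    [set (psi2 z.1 z.2)^-1%:E *
         \int[lebesgue_measure]_(t in `]z.2, +oo[)
           (ereal_inf [set (psi1 z.1 l)%:E
                           * wmeas (wpow w1 p) (Ball z.1 l) `^ p^-1
                      | l in [set l : R | (t <= l)%R]]
            * (wmeas (wpow w2 q) (Ball z.1 t) `^ q^-1)^-1
            * (t^-1)%:E)
    | z in [set z : T * R | (0 < z.2)%R]] < +oo.

End weighted_spaces.

(* Main.v *)
Require Import Defs.
From mathcomp Require Import all_boot all_order all_algebra.
From mathcomp Require Import all_classical all_reals all_analysis.
From mathcomp Require Import measurable_realfun ess_sup_inf.
From mathcomp Require Import ring lra.
Import Order.TTheory GRing.Theory Num.Theory.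
Import numFieldNormedType.Exports.
Local Open Scope classical_set_scope.
Local Open Scope ring_scope.

Set Implicit Arguments.
Unset Strict Implicit.
Unset Printing Implicit Defensive.

(** Fix a ball B = B(a, r) and split f = f1 + f2 with f1 = f on B(a, 2r).  Write
    u(a, t) = w2^q(B(a, t))^(1/q), and I(a, t) for the infimum over l >= t of
    psi1(a, l) w1^p(B(a, l))^(1/p), which is the numerator in the condition on
    psi1 and psi2.  Monotonicity in the radius and the Morrey norm M of f give
    [|f|]_(L^(p,w1^p)(B(a,t))) <= M I(a, t) ([morrey_Lnrm_le]), so it is enough
    to bound everything by I(a, .) / u(a, .) at dyadic radii.

    The weight condition enters only through Hoelder's inequality.  For every
    ball it yields the testing inequality ([Apq_testing])
      [|g|]_(L^s(B)) w2^q(B)^(1/q)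
        <= C r^(n/s - n/p + n/q) [|g|]_(L^(p,w1^p)(B)),
    where n/s - n/p + n/q = n/s - alpha is opposite to the exponent in the size
    condition.  Hence on B the function S f2 is bounded by a constant times
    M times the sum over k >= 1 of I(a, 2^(k+1) r) / u(a, 2^(k+1) r)
    ([size_condition_morrey]).  The same testing inequality for the pair
    (w2, w2), applied to the indicator of the half ball, makes w2^q doubling
    ([testing_doubling]); since I is nondecreasing, the sum over all k >= 0 is
    then dominated by the integral of I(a, t) / (u(a, t) t) over t > r
    ([nneseries_dyadic_le]), that is by a multiple of psi2(a, r)
    ([psi_condition_sum]).  The term k = 0 of that sum controls S f1: by the
    assumed boundedness the global norm of S f1 is at most a multiple of
    M I(a, 2r), and I(a, 2r) <= K psi2(a, r) u(a, 2r) with u(a, 2r) comparable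
    to u(a, r).  Adding the two parts and dividing by psi2(a, r) u(a, r) is
    [bounded_morrey].

    Strong and weak type are treated at once: the argument only needs a target
    functional N for which N_B(S f) is controlled by N(S f1) and by the sup of
    |S f2| on B times u(a, r), and both the weighted L^q norm
    ([integral_powR_split]) and the weak norm ([weak_level_split]) are of this
    kind. *)

Local Open Scope ereal_scope.

(** * The Lebesgue measure of Euclidean balls *)

(** The measure is an iterated product of one-dimensional Lebesgue measures, so
    the measure of a cube follows by induction on the dimension; enclosing a ball
    between two cubes then gives bounds proportional to r ^ n. *)
Definition cube (R : realType) (n : nat) (a : n.-tuple R) (h : R) :
    set (n.-tuple (measurableTypeR R)) :=
  [set x | forall i, (`|tnth x i - tnth a i| < h)%R].

Lemma cube_tcons (R : realType) (n : nat) (a : n.+1.-tuple R) (h : R) :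
  @tcons R n @^-1` cube a h =
  `](thead a - h)%R, (thead a + h)%R[%classic `*` cube [tuple of behead a] h.
Proof.
have E t x i : tnth (@tcons R n (x, t)) (lift ord0 i) = tnth t i.
  by rewrite /tcons tnthS/=.
have E' i : tnth a (lift ord0 i) = tnth [tuple of behead a] i.
  by rewrite tnth_behead; congr tnth; apply/val_inj; rewrite /= inordK ?ltnS.
have E0 x : (x \in `](thead a - h)%R, (thead a + h)%R[) = (`|x - thead a| < h)%R.
  by rewrite in_itv/= distrC ltr_distlC.
apply/seteqP; split=> [[x t]|[x t]] /=.
  move=> H; split; first by rewrite /= E0; exact: (H ord0).
  by move=> i; have := H (lift ord0 i); rewrite E E'.
rewrite E0 => -[/= H1 H2] i.
have [->|[j ->]] : i = ord0 \/ exists j, i = lift ord0 j.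
  by case: (unliftP ord0 i) => [j ->|->]; [right; exists j|left].
  exact: H1.
by rewrite E E'; exact: H2.
Qed.

Lemma measurable_cube (R : realType) (n : nat) (a : n.-tuple R) (h : R) :
  measurable (cube a h).
Proof.
rewrite (_ : cube a h = \bigcap_(i in [set: 'I_n])
   ((fun x : n.-tuple (measurableTypeR R) => tnth x i) @^-1`
      `](tnth a i - h)%R, (tnth a i + h)%R[%classic)); last first.
  have E i y : (`|y - tnth a i| < h)%R =
      (y \in `](tnth a i - h)%R, (tnth a i + h)%R[) by rewrite in_itv/= distrC ltr_distlC.
  apply/seteqP; split=> x /= H i => [_|]; first by rewrite /= -E; exact: H.
  by have := H i I; rewrite /= -E.
apply: fin_bigcap_measurable => // i _.
rewrite -[X in measurable X]setTI; apply: measurable_tnth => //.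
Qed.

Lemma borel_lebesgue_cube (R : realType) (n : nat) (a : n.-tuple R) (h : R) :
  (0 <= h)%R -> borel_lebesgue R n (cube a h) = ((2 * h) ^+ n)%:E.
Proof.
move=> h0; elim: n a => [|n IH] a.
  rewrite /= diracE mem_set ?expr0//= => -[]//.
rewrite /= /cons_measure /pushforward cube_tcons.
rewrite product_measure1E//; last exact: measurable_cube.
rewrite exprS EFinM; congr (_ * _); last exact: IH.
apply: (etrans (lebesgue_measure_itv _)); rewrite /= lte_fin.
case: ltP => h1; last first.
  by congr EFin; lra.
by rewrite -EFinD; congr EFin; ring.
Qed.

Section ball.
Context (R : realType) (n : nat).
Local Notation T := (Rn R n).
Local Notation mu := (leb R n).

Lemma measurable_coord (i : 'I_n) :
  measurable_fun [set: T] (fun x : T => Defs.coord x i).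
Proof.
move=> _ Y mY; rewrite setTI.
apply: caratheodory_measurable_mu_ext.
by rewrite -[X in measurable X]setTI; apply: measurable_tnth.
Qed.

Lemma measurable_Ball (a : T) r : measurable (Ball a r).
Proof.
pose f (x : T) := Num.sqrt (\sum_(i < n) (Defs.coord x i - Defs.coord a i) ^+ 2)%R.
rewrite (_ : Ball a r = [set: T] `&` f @^-1` `]-oo, r[%classic); last first.
  by rewrite setTI; apply/seteqP; split=> x /=; rewrite in_itv/=.
have mf : measurable_fun [set: T] f.
  apply: (measurableT_comp (continuous_measurable_fun (@sqrt_continuous R))).
  apply: measurable_sum => i; apply: measurable_funX.
  exact: (measurable_funB (measurable_coord i) (measurable_cst _)).
exact: mf.
Qed.

Lemma leb_cube (a : T) h : (0 <= h)%R ->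
  mu (cube (a : n.-tuple R) h : set T) = ((2 * h) ^+ n)%:E.
Proof.
move=> h0; rewrite -(borel_lebesgue_cube (a : n.-tuple R) h0).
exact: (@measurable_mu_extE _ _ _ (borel_lebesgue R n) _ (measurable_cube _ _)).
Qed.

Lemma measurable_cubeT (a : T) h : measurable (cube (a : n.-tuple R) h : set T).
Proof. by apply: caratheodory_measurable_mu_ext; exact: measurable_cube. Qed.

Lemma leb_Ball_le (a : T) r : (0 < r)%R -> mu (Ball a r) <= ((2 * r) ^+ n)%:E.
Proof.
move=> r0; rewrite -(leb_cube a (ltW r0)); apply: le_measure; rewrite ?inE.
- exact: measurable_Ball.
- exact: measurable_cubeT.
move=> x /=; rewrite /Ball/= => H i; apply: le_lt_trans H.
rewrite -sqrtr_sqr ler_wsqrtr// (bigD1 i)//= lerDl.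
by apply: sumr_ge0 => j _; exact: sqr_ge0.
Qed.

(** The half side r / (n + 1) makes the sum of squares strictly smaller than
    r ^ 2, so that the cube lies in the open ball in every dimension. *)
Lemma leb_Ball_ge (a : T) r : (0 < r)%R ->
  ((2 * (r / n.+1%:R)) ^+ n)%:E <= mu (Ball a r).
Proof.
move=> r0; have h0 : (0 <= r / n.+1%:R)%R by rewrite divr_ge0// ltW.
rewrite -(leb_cube a h0); apply: le_measure; rewrite ?inE.
- exact: measurable_cubeT.
- exact: measurable_Ball.
move=> x /= H; rewrite /Ball/= -(ger0_norm (ltW r0)) -sqrtr_sqr ltr_sqrt ?exprn_gt0//.
apply: (@le_lt_trans _ _ (\sum_(i < n) (r / n.+1%:R) ^+ 2)%R).
  apply: ler_sum => i _; rewrite -[X in (X <= _)%R]real_normK ?num_real//.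
  by apply: lerXn2r; rewrite ?nnegrE// ltW//; exact: H.
rewrite sumr_const card_ord -[X in (X < _)%R]mulr_natr expr_div_n -mulrA gtr_pMr ?exprn_gt0//.
rewrite mulrC ltr_pdivrMr ?exprn_gt0// mul1r -natrX ltr_nat.
by rewrite expnS expn1 (leq_trans (ltnSn n))// leq_pmulr.
Qed.

End ball.

(** * Hoelder's inequality in dual form *)

Lemma lee_poweR (R : realType) (x y : \bar R) (r : R) :
  (0 <= r)%R -> 0 <= x -> x <= y -> x `^ r <= y `^ r.
Proof.
move=> r0 x0 xy; apply: gt0_ler_poweR => //; rewrite in_itv/= leey andbT//.
exact: le_trans xy.
Qed.

Section hoelder_restricted.
Context d (T : measurableType d) (R : realType) (mu : {measure set T -> \bar R}).
Implicit Types (D : set T) (f g w : T -> R).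

Lemma measurable_powRT f (p : R) : measurable_fun [set: T] f ->
  measurable_fun [set: T] (fun x => f x `^ p)%R.
Proof. exact: (@measurableT_comp _ _ _ _ _ _ (@powR R ^~ p)). Qed.

Lemma hoelder_integral D f g (p q : R) : measurable D ->
  measurable_fun [set: T] f -> measurable_fun [set: T] g ->
  (forall x, (0 <= f x)%R) -> (forall x, (0 <= g x)%R) ->
  (0 < p)%R -> (0 < q)%R -> (p^-1 + q^-1 = 1)%R ->
  \int[mu]_(x in D) (f x * g x)%:E <=
  (\int[mu]_(x in D) (f x `^ p)%:E) `^ p^-1 *
  (\int[mu]_(x in D) (g x `^ q)%:E) `^ q^-1.
Proof.
move=> mD mf mg f0 g0 p0 q0 pq.
have mfD (h : T -> R) : measurable_fun [set: T] h ->
    measurable_fun [set: T] (fun x => h x * \1_D x)%R.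
  by move=> mh; apply: measurable_funM => //; exact: measurable_indic.
have := hoelder mu (mfD _ mf) (mfD _ mg) p0 q0 pq.
have E (h : T -> R) r : (forall x, (0 <= h x)%R) -> (0 < r)%R ->
    'N[mu]_r%:E[EFin \o (fun x => h x * \1_D x)%R] =
    (\int[mu]_(x in D) (h x `^ r)%:E) `^ r^-1.
  move=> h0 r0; rewrite Lnorm.unlock; congr (_ `^ _).
  rewrite [RHS]integral_mkcond; apply: eq_integral => x _.
  rewrite patchE /= ?indicE; case: ifPn => xD.
    by rewrite mulr1 ger0_norm.
  by rewrite mulr0 normr0 powR0// gt_eqF.
rewrite !E// Lnorm1; apply: le_trans.
rewrite integral_mkcond le_eqVlt; apply/orP; left; apply/eqP.
apply: eq_integral => x _; rewrite patchE /= ?indicE; case: ifPn => xD.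
  by rewrite !mulr1 ger0_norm// mulr_ge0.
by rewrite !mulr0 normr0.
Qed.

(** Hoelder applied to f = (f w) w^-1, an identity that holds almost everywhere
    since w vanishes on a null set only. *)
Lemma integral_le_dual D f w (p p' : R) : measurable D ->
  measurable_fun [set: T] f -> measurable_fun [set: T] w ->
  (forall x, (0 <= f x)%R) -> (forall x, (0 <= w x)%R) ->
  {ae mu, forall x, (0 < w x)%R} -> (0 < p)%R -> (0 < p')%R -> (p^-1 + p'^-1 = 1)%R ->
  \int[mu]_(x in D) (f x)%:E <=
  (\int[mu]_(x in D) (f x `^ p * w x `^ p)%:E) `^ p^-1 *
  (\int[mu]_(x in D) (w x `^ (- p'))%:E) `^ p'^-1.
Proof.
move=> mD mf mw f0 w0 wpos p0 p'0 pp'.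
have mfw : measurable_fun [set: T] (fun x => f x * w x)%R by exact: measurable_funM.
have mv := measurable_powRT (-1) mw.
have H := hoelder_integral mD mfw mv (fun x => mulr_ge0 (f0 x) (w0 x))
  (fun x => powR_ge0 _ _) p0 p'0 pp'.
rewrite [X in X <= _](_ : _ = \int[mu]_(x in D) (f x * w x * w x `^ -1)%:E).
  apply: (le_trans H); rewrite le_eqVlt; apply/orP; left; apply/eqP.
  congr (_ `^ _ * _ `^ _); apply: eq_integral => x _.
    by rewrite powRM.
  by rewrite -powRrM mulN1r.
apply: ge0_ae_eq_integral => //.
- by apply/measurable_EFinP; exact: measurable_funTS.
- by apply/measurable_EFinP; apply: measurable_funTS; exact: measurable_funM.
- by move=> x _; rewrite lee_fin.
- by move=> x _; rewrite lee_fin mulr_ge0 ?powR_ge0// mulr_ge0.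
apply: filterS wpos => x wx _.
by rewrite powRN powRr1// mulfK// gt_eqF.
Qed.

(** The endpoint p = 1 of the previous duality, with the essential supremum of
    1 / w in place of the dual norm. *)
Lemma integral_le_dual1 D f w : measurable D -> 0 < mu [set: T] ->
  measurable_fun [set: T] f -> measurable_fun [set: T] w ->
  (forall x, (0 <= f x)%R) -> (forall x, (0 <= w x)%R) ->
  {ae mu, forall x, (0 < w x)%R} ->
  \int[mu]_(x in D) (f x)%:E <=
  (\int[mu]_(x in D) (f x * w x)%:E) *
  'N[mu]_(+oo)[(EFin \o (fun x => (w x)^-1%R)) \_ D].
Proof.
move=> mD muT mf mw f0 w0 wpos; rewrite unlock muT.
set L := ess_sup _ _.
have Lge := ess_sup_ge mu (abse \o ((EFin \o (fun x => (w x)^-1%R)) \_ D)).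
have L0 : 0 <= L by apply: ess_sup_gee => //; apply: nearW => x /=.
rewrite -ge0_integralZr//; last 2 first.
- by apply/measurable_EFinP; apply: measurable_funTS; exact: measurable_funM.
- by move=> x _; rewrite lee_fin mulr_ge0.
apply: ae_ge0_le_integral => //.
- by move=> x _; rewrite lee_fin.
- by apply/measurable_EFinP; exact: measurable_funTS.
- by move=> x _; rewrite mule_ge0// lee_fin mulr_ge0.
- apply: emeasurable_funM => //.
  by apply/measurable_EFinP; apply: measurable_funTS; exact: measurable_funM.
apply: filterS2 wpos Lge => x wx /=; rewrite -/L => Lx Dx.
rewrite patchE mem_set//= in Lx.
rewrite EFinM -muleA -[leLHS]mule1; apply: lee_wpmul2l; first by rewrite lee_fin.
apply: (@le_trans _ _ ((w x)%:E * `|(w x)^-1|%:E)).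
  by rewrite -EFinM lee_fin ger0_norm ?invr_ge0// divff// gt_eqF.
by apply: lee_wpmul2l => //; rewrite lee_fin.
Qed.

Lemma integral_powM_restrict D f w (t : R) : (0 < t)%R ->
  \int[mu]_x (`|f x * \1_D x| `^ t * w x)%:E =
  \int[mu]_(x in D) (`|f x| `^ t * w x)%:E.
Proof.
move=> t0; rewrite [RHS]integral_mkcond; apply: eq_integral => x _.
rewrite patchE /= indicE; case: ifPn => _; first by rewrite mulr1.
by rewrite mulr0 normr0 powR0 ?gt_eqF// mul0r.
Qed.

Lemma subset_integral_powM D E f w (t : R) : measurable D -> measurable E ->
  measurable_fun [set: T] f -> measurable_fun [set: T] w ->
  (forall x, (0 <= w x)%R) -> D `<=` E ->
  \int[mu]_(x in D) (`|f x| `^ t * w x)%:E <=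
  \int[mu]_(x in E) (`|f x| `^ t * w x)%:E.
Proof.
move=> mD mE mf mw w0 DE; apply: ge0_subset_integral => //.
- apply/measurable_EFinP; apply: measurable_funTS; apply: measurable_funM => //.
  by apply: measurable_powRT; exact: measurableT_comp.
- by move=> x _; rewrite lee_fin mulr_ge0 ?powR_ge0.
Qed.

End hoelder_restricted.

(** * The testing inequality on balls *)

Section testing.
Context (R : realType) (n : nat).
Local Notation T := (Rn R n).
Local Notation mu := (leb R n).

(** What the duality arguments use of a weight; unlike local integrability, it
    is inherited by every real power. *)
Definition ae_positive (w : T -> R) : Prop :=
  [/\ measurable_fun [set: T] w, forall x, (0 <= w x)%R &
      {ae mu, forall x, (0 < w x)%R}].

Lemma ae_positive_wpow (w : T -> R) (s : R) :
  ae_positive w -> ae_positive (wpow w s).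
Proof.
case=> mw w0 wpos; split.
- exact: measurable_powRT.
- by move=> x; exact: powR_ge0.
- by apply: filterS wpos => x; exact: powR_gt0.
Qed.

Lemma wpowM (w : T -> R) (s t : R) : wpow (wpow w s) t = wpow w (s * t)%R.
Proof. by apply/funext => x; rewrite /wpow powRrM. Qed.

Lemma leb_Ball_fin (a : T) (r : R) : (0 < r)%R ->
  exists2 m : R, mu (Ball a r) = m%:E & (0 < m <= (2 * r) ^+ n)%R.
Proof.
move=> r0; have h1 := leb_Ball_le a r0; have h2 := leb_Ball_ge a r0.
have gt0 : 0 < mu (Ball a r).
  by apply: lt_le_trans h2; rewrite lte_fin exprn_gt0// mulr_gt0// divr_gt0.
exists (fine (mu (Ball a r))).
  by rewrite fineK// ge0_fin_numE// (le_lt_trans h1)// ltry.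
have fin : mu (Ball a r) \is a fin_num by rewrite ge0_fin_numE// (le_lt_trans h1)// ltry.
by rewrite -lte_fin -lee_fin fineK// gt0 h1.
Qed.

Lemma average_poweR (E : set T) (m : R) (g : T -> R) (t : R) :
  mu E = m%:E -> (0 < m)%R -> (forall x, (0 <= g x)%R) ->
  average E g `^ t =
  (m `^ (- t))%:E * (\int[mu]_(x in E) (g x)%:E) `^ t.
Proof.
move=> mE m0 g0; rewrite /average mE inver gt_eqF// poweRM//; last 2 first.
- by rewrite lee_fin invr_ge0 ltW.
- by apply: integral_ge0 => x _; rewrite lee_fin.
by congr (_ * _); rewrite poweR_EFin -powR_inv1 ?ltW// -powRrM mulN1r.
Qed.

(** The averages in the weight condition carry the powers of |B| that turn into
    the power of r here. Both branches of the condition (dual integral for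
    P > 1, essential supremum for P = 1) serve as a dual factor D. *)
Lemma Apq_integral_le (P Q : R) (w1 w2 : T -> R) :
  ae_positive w1 -> ae_positive w2 -> (1 <= P)%R -> (0 < Q)%R ->
  Apq P Q w1 w2 ->
  exists2 C : R, (0 < C)%R & forall a r (f : T -> R), (0 < r)%R ->
    measurable_fun [set: T] f -> (forall x, (0 <= f x)%R) ->
    (\int[mu]_(x in Ball a r) (f x)%:E) *
      wmeas (wpow w2 Q) (Ball a r) `^ Q^-1 <=
    (C * r `^ (n%:R * (1 - P^-1 + Q^-1)))%:E *
      (\int[mu]_(x in Ball a r) (f x `^ P * w1 x `^ P)%:E) `^ P^-1.
Proof.
move=> [mw1 w10 w1pos] [mw2 w20 w2pos] P1 Q0 [C [C0 HA]].
have P0 : (0 < P)%R by rewrite (lt_le_trans ltr01).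
pose e := (1 - P^-1 + Q^-1)%R.
have e0 : (0 <= e)%R.
  by rewrite addr_ge0 ?invr_ge0 ?(ltW Q0)// subr_ge0 invf_le1.
exists (C * (2 ^+ n) `^ e)%R; first by rewrite mulr_gt0// powR_gt0 exprn_gt0.
move=> a r f r0 mf f0.
have [m mE /andP[m0 mle]] := leb_Ball_fin a r0.
have mB : measurable (Ball a r) := measurable_Ball a r.
have {}HA := HA a r r0.
have E2 := average_poweR Q^-1 mE m0 (fun x => powR_ge0 (w2 x) Q).
rewrite [X in X * _ <= _]E2 in HA.
rewrite -/(wmeas (wpow w2 Q) (Ball a r)) in HA.
set J := _ `^ Q^-1 in HA *.
have J0 : 0 <= J by exact: poweR_ge0.
suff [D [D0 HfD HJD]] : exists D : \bar R, [/\ 0 <= D,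
    \int[mu]_(x in Ball a r) (f x)%:E <=
      (\int[mu]_(x in Ball a r) (f x `^ P * w1 x `^ P)%:E) `^ P^-1 * D &
    J * D <= (C * m `^ e)%:E].
  apply: (le_trans (lee_wpmul2r J0 HfD)).
  rewrite -muleA [D * _]muleC [leRHS]muleC.
  apply: lee_wpmul2l; first exact: poweR_ge0.
  apply: (le_trans HJD); rewrite lee_fin -mulrA ler_pM2l//.
  rewrite powRrM -powRM ?exprn_ge0 ?powR_ge0//.
  rewrite powR_mulrn ?(ltW r0)// -exprMn.
  have r20 : (0 <= (2 * r) ^+ n)%R by rewrite exprn_ge0// mulr_ge0// ltW.
  apply: (@ge0_ler_powR _ e e0 m ((2 * r) ^+ n)%R _ _ mle); rewrite nnegrE//.
  exact: ltW.
have K (D : \bar R) t : (m `^ (- t))%:E * D <= C%:E -> D <= (C * m `^ t)%:E.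
  have mt : (0 < m `^ t)%R by rewrite powR_gt0.
  move=> H; have := lee_wpmul2l (_ : 0 <= (m `^ t)%:E) H.
  rewrite lee_fin (ltW mt) => /(_ isT).
  by rewrite muleA -EFinM powRN divff ?gt_eqF// mul1e -EFinM mulrC.
case: ifPn HA => [/eqP P1E|Pn1] HA.
  exists (Linfty_norm (Ball a r) (fun x => (w1 x)^-1)%R); split.
  - exact: Lnorm_ge0.
  - rewrite P1E invr1 poweRe1; last first.
      by apply: integral_ge0 => x _; rewrite lee_fin mulr_ge0 ?powR_ge0.
    under [X in _ <= X * _]eq_integral do rewrite !powRr1//.
    apply: integral_le_dual1 => //.
    apply: (@lt_le_trans _ _ (mu (Ball a r))); first by rewrite mE lte_fin.
    by apply: le_measure; rewrite ?inE.
  - apply: K; rewrite /e P1E invr1 subrr add0r.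
    by move: HA; rewrite -muleA.
have P1' : (1 < P)%R by rewrite lt_neqAle eq_sym Pn1.
move: HA; set p' := ((1 - P^-1)^-1)%R.
have E1 := average_poweR p'^-1 mE m0 (fun x => powR_ge0 (w1 x) (- p')).
rewrite [X in _ * X <= _]E1.
have p'0 : (0 < p')%R by rewrite invr_gt0 subr_gt0 invf_lt1.
have pp' : (P^-1 + p'^-1 = 1)%R by rewrite invrK addrC subrK.
move=> HA; exists ((\int[mu]_(x in Ball a r) (w1 x `^ (- p'))%:E) `^ p'^-1); split.
- exact: poweR_ge0.
- exact: integral_le_dual.
- apply: K; move: HA; rewrite muleACA -EFinM -powRD; last first.
    by rewrite (gt_eqF m0) implybT.
  by rewrite -opprD /e invrK [(Q^-1 + _)%R]addrC.
Qed.

Lemma LnrmE (p : R) (w : T -> R) (E : set T) (f : T -> R) :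
  Lnrm p w E (EFin \o f) = (\int[mu]_(x in E) (`|f x| `^ p * w x)%:E) `^ p^-1.
Proof. by congr (_ `^ _); apply: eq_integral => x _; rewrite /= -EFinM. Qed.

(** The only form in which the weight condition is used afterwards: it no longer
    distinguishes p = 1 from p > 1, and its left side is the local L^s average
    appearing in the size condition. *)
Definition testing_ineq (p q s : R) (w1 w2 : T -> R) (C : R) : Prop :=
  forall a r (f : T -> R), (0 < r)%R -> measurable_fun [set: T] f ->
    (\int[mu]_(x in Ball a r) (`|f x| `^ s)%:E) `^ s^-1 *
      wmeas (wpow w2 q) (Ball a r) `^ q^-1 <=
    (C * r `^ (n%:R * (s^-1 - p^-1 + q^-1)))%:E *
      Lnrm p (wpow w1 p) (Ball a r) (EFin \o f).

(** The case of |f|^s and of the weights w1^s, w2^s, raised to the power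
    1 / s. *)
Lemma Apq_testing (p q s : R) (w1 w2 : T -> R) :
  ae_positive w1 -> ae_positive w2 -> (0 < s)%R -> (s <= p)%R -> (0 < q)%R ->
  Apq (p / s) (q / s) (wpow w1 s) (wpow w2 s) ->
  exists2 C : R, (0 < C)%R & testing_ineq p q s w1 w2 C.
Proof.
move=> Hw1 Hw2 s0 sp q0 HA.
have ps1 : (1 <= p / s)%R by rewrite ler_pdivlMr// mul1r.
have [C C0 HC] := Apq_integral_le (ae_positive_wpow s Hw1)
  (ae_positive_wpow s Hw2) ps1 (divr_gt0 q0 s0) HA.
exists (C `^ s^-1)%R; first by rewrite powR_gt0.
have p0 : (0 < p)%R by rewrite (lt_le_trans s0).
have s0' : (s != 0)%R by rewrite gt_eqF.
have p0' : (p != 0)%R by rewrite gt_eqF.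
have q0' : (q != 0)%R by rewrite gt_eqF.
move=> a r f r0 mf.
have mfs : measurable_fun [set: T] (fun x => `|f x| `^ s)%R.
  by apply: measurable_powRT; exact: measurableT_comp.
have := HC a r _ r0 mfs (fun x => powR_ge0 _ _).
have pE t : (s * (t / s) = t)%R by rewrite mulrCA divff// mulr1.
rewrite wpowM pE.
under [X in _ <= _ * X `^ _]eq_integral do rewrite /wpow -!powRrM !pE.
have I0 (g : T -> R) : (forall x, (0 <= g x)%R) ->
    0 <= \int[mu]_(x in Ball a r) (g x)%:E.
  by move=> g0; apply: integral_ge0 => x _; rewrite lee_fin.
have Cr0 t : (0 <= C * r `^ t)%R by rewrite mulr_ge0 ?powR_ge0 ?(ltW C0).
move=> /(@lee_poweR _ _ _ s^-1); rewrite invr_ge0 (ltW s0) => /(_ isT).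
rewrite mule_ge0 ?poweR_ge0 ?I0// => /(_ isT).
rewrite !poweRM ?poweR_ge0 ?lee_fin ?I0 ?Cr0//.
rewrite poweR_EFin powRM ?powR_ge0 ?(ltW C0)// -powRrM -!poweRrM LnrmE.
have vE t : (t != 0 -> (t / s)^-1 / s = t^-1)%R by move=> t0; field; rewrite t0 s0'.
rewrite !vE//.
rewrite (_ : (_ / s)%R = n%:R * (s^-1 - p^-1 + q^-1))%R//.
by field; rewrite s0' p0' q0'.
Qed.

End testing.

(** * Local finiteness, positivity and doubling of the target weight *)

Lemma integral_ae_gt0 d (T : measurableType d) (R : realType)
    (mu : {measure set T -> \bar R}) (D : set T) (f : T -> R) :
  measurable D -> 0 < mu D -> measurable_fun [set: T] f ->
  (forall x, (0 <= f x)%R) -> {ae mu, forall x, (0 < f x)%R} ->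
  0 < \int[mu]_(x in D) (f x)%:E.
Proof.
move=> mD muD mf f0 fpos; rewrite lt0e integral_ge0 ?andbT; last first.
  by move=> x _; rewrite lee_fin.
apply/eqP => int0.
have mfD : measurable_fun D (EFin \o f).
  by apply/measurable_EFinP; exact: measurable_funTS.
have /(ae_eq_integral_abs mu mD mfD) f_ae0 :
    \int[mu]_(x in D) `|(EFin \o f) x| = 0.
  by rewrite -[RHS]int0; apply: eq_integral => x _; rewrite /= ger0_norm.
have : mu.-negligible D.
  rewrite -[D]setCK; change ({ae mu, forall x, (~` D) x}).
  apply: filterS2 fpos f_ae0 => x fx /= H Dx.
  by have [] := H Dx => fx0; rewrite fx0 ltxx in fx.
by move=> /(measure_negligible mD) muD0; rewrite muD0 ltxx in muD.
Qed.

Lemma integral_le1 d (T : measurableType d) (R : realType)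
    (mu : {measure set T -> \bar R}) (D : set T) (f : T -> R) :
  measurable D -> measurable_fun [set: T] f ->
  (forall x, (0 <= f x <= 1)%R) -> \int[mu]_(x in D) (f x)%:E <= mu D.
Proof.
move=> mD mf f01; rewrite -[leRHS]mul1e -(integral_cst mu mD 1).
apply: ge0_le_integral => //.
- by move=> x _; rewrite lee_fin; case/andP: (f01 x).
- by apply/measurable_EFinP; exact: measurable_funTS.
- by move=> x _; rewrite /= lee_fin; case/andP: (f01 x).
Qed.

Section testing_consequences.
Context (R : realType) (n : nat).
Local Notation T := (Rn R n).
Local Notation mu := (leb R n).

Lemma le_Ball (a : T) (r t : R) : (r <= t)%R -> Ball a r `<=` Ball a t.
Proof. by move=> rt x; rewrite /Ball /= => /lt_le_trans; exact. Qed.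

Lemma le_wmeas_Ball (w : T -> R) (a : T) (r t : R) :
  measurable_fun [set: T] w -> (forall x, (0 <= w x)%R) -> (r <= t)%R ->
  wmeas w (Ball a r) <= wmeas w (Ball a t).
Proof.
move=> mw w0 rt; apply: ge0_subset_integral; first exact: measurable_Ball.
- exact: measurable_Ball.
- by apply/measurable_EFinP; exact: measurable_funTS.
- by move=> x _; rewrite lee_fin.
- exact: le_Ball.
Qed.

Lemma wmeas_Ball_gt0 (w : T -> R) (a : T) (r : R) : ae_positive w -> (0 < r)%R ->
  0 < wmeas w (Ball a r).
Proof.
move=> [mw w0 wpos] r0; apply: integral_ae_gt0 => //; first exact: measurable_Ball.
have [m -> /andP[m0 _]] := leb_Ball_fin a r0; by rewrite lte_fin.
Qed.

(** Testing against f = 1 / (1 + w1): the right side is finite as f w1 <= 1,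
    and the left side has a positive factor because f > 0. *)
Lemma testing_wmeas_fin (p q s C : R) (w1 w2 : T -> R) (a : T) (r : R) :
  ae_positive w1 -> (0 < p)%R -> (0 < q)%R -> (0 < s)%R ->
  testing_ineq p q s w1 w2 C -> (0 < r)%R ->
  wmeas (wpow w2 q) (Ball a r) < +oo.
Proof.
move=> [mw1 w10 w1pos] p0 q0 s0 HC r0.
have mB : measurable (Ball a r) := measurable_Ball a r.
have [m mE /andP[m0 _]] := leb_Ball_fin a r0.
pose f (x : T) := ((1 + w1 x) `^ (-1))%R.
have f0 x : (0 < f x)%R by rewrite powR_gt0// ltr_pwDl.
have mf : measurable_fun [set: T] f.
  by apply: measurable_powRT; exact: measurable_funD.
have mf' t : measurable_fun [set: T] (fun x => `|f x| `^ t)%R.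
  by apply: measurable_powRT; exact: measurableT_comp.
have fw x : (`|f x| `^ p * wpow w1 p x <= 1)%R.
  rewrite /wpow -powRM// ger0_norm ?(ltW (f0 x))//.
  have fw1 : (f x * w1 x <= 1)%R.
    have h : (0 < 1 + w1 x)%R by rewrite ltr_pwDl.
    by rewrite /f powRN powRr1 ?(ltW h)// mulrC ler_pdivrMr// mul1r lerDr.
  rewrite (_ : 1 = 1 `^ p)%R; last by rewrite powR1.
  apply: ge0_ler_powR => //; rewrite ?nnegrE ?mulr_ge0 ?(ltW (f0 x))//.
  exact: ltW.
have intle : \int[mu]_(x in Ball a r) (`|f x| `^ p * wpow w1 p x)%:E <= m%:E.
  have fw01 x : (0 <= `|f x| `^ p * wpow w1 p x <= 1)%R.
    by rewrite fw mulr_ge0 ?powR_ge0.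
  have := integral_le1 mu mB (measurable_funM (mf' p) (measurable_powRT p mw1)) fw01.
  by move=> /le_trans; apply; rewrite mE.
have := HC a r f r0 mf; rewrite LnrmE.
set X := (X in X * _ <= _); set Y := (X in _ * X <= _); set Z := (X in _ <= _ * X).
have X0 : 0 < X.
  apply: poweR_gt0; apply: integral_ae_gt0 => //.
  - by rewrite mE lte_fin.
  - by apply: aeW => x; rewrite powR_gt0// normr_gt0 gt_eqF.
have Zoo : Z < +oo by apply: poweR_lty; apply: le_lt_trans intle _; exact: ltry.
have Zf : Z \is a fin_num by rewrite ge0_fin_numE// poweR_ge0.
rewrite -(fineK Zf) -EFinM => XY.
apply: (@lty_poweRy _ _ q^-1); first by rewrite gt_eqF// invr_gt0.
rewrite ltey; apply/eqP => Yoo; move: XY.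
by rewrite /Y Yoo gt0_muley// leye_eq.
Qed.

(** Since p < q, this is Hoelder with the constant function 1. *)
Lemma wmeas_jensen (p q : R) (w : T -> R) (a : T) (r m : R) :
  ae_positive w -> (0 < p)%R -> (p < q)%R -> (0 < r)%R -> mu (Ball a r) = m%:E ->
  wmeas (wpow w p) (Ball a r) `^ p^-1 <=
  wmeas (wpow w q) (Ball a r) `^ q^-1 * (m `^ (p^-1 - q^-1))%:E.
Proof.
move=> [mw w0 wpos] p0 pq r0 mE.
have q0 : (0 < q)%R by exact: lt_trans pq.
have mB : measurable (Ball a r) := measurable_Ball a r.
pose t := ((1 - p / q)^-1)%R.
have t0 : (0 < t)%R by rewrite invr_gt0 subr_gt0 ltr_pdivrMr// mul1r.
have := @hoelder_integral _ _ _ mu (Ball a r) (wpow w p) (fun=> 1%R) (q / p) t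
  mB (measurable_powRT p mw) (measurable_cst _) (fun x => powR_ge0 _ _)
  (fun=> ler01) (divr_gt0 q0 p0) t0.
rewrite /t invrK invf_div addrC subrK => /(_ erefl).
under [X in _ <= _ * X `^ _]eq_integral do rewrite powR1.
rewrite (integral_cst mu mB 1) mul1e mE.
under [X in X <= _]eq_integral do rewrite mulr1.
rewrite -/(wmeas _ _).
under [X in _ <= X `^ _ * _]eq_integral do rewrite /wpow -powRrM mulrCA divff ?gt_eqF// mulr1.
rewrite -/(wmeas (wpow w q) _).
have pos z : 0 <= wmeas (wpow w z) (Ball a r).
  by apply: integral_ge0 => x _; rewrite lee_fin powR_ge0.
move=> /(@lee_poweR _ _ _ p^-1); rewrite invr_ge0 (ltW p0) pos => /(_ isT isT).
move=> /le_trans; apply; rewrite poweRM ?poweR_ge0// -!poweRrM.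
rewrite poweR_EFin le_eqVlt; apply/orP; left; apply/eqP.
have p0' : (p != 0)%R by rewrite gt_eqF.
have q0' : (q != 0)%R by rewrite gt_eqF.
congr (_ `^ _ * (_ `^ _)%:E).
  by field; rewrite p0' q0'.
by field; rewrite p0' q0'.
Qed.

(** Testing on B(a, 2r) against the indicator of B(a, r): the left side is
    |B(a, r)|^(1/s) w^q(B(a, 2r))^(1/q), and the right side contains the integral
    of w^p over B(a, r), which the previous lemma bounds by w^q(B(a, r)). The powers of the measures
    of the two balls cancel up to a dimensional constant. *)
Lemma testing_doubling (p q s C : R) (w : T -> R) :
  ae_positive w -> (0 < s)%R -> (s <= p)%R -> (p < q)%R -> (0 < C)%R ->
  testing_ineq p q s w w C ->
  exists2 D : R, (0 < D)%R & forall a r, (0 < r)%R ->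
    wmeas (wpow w q) (Ball a (2 * r)%R) `^ q^-1 <=
    D%:E * wmeas (wpow w q) (Ball a r) `^ q^-1.
Proof.
move=> Hw s0 sp pq C0 HC; have [mw w0 wpos] := Hw.
have p0 : (0 < p)%R by exact: lt_le_trans sp.
have q0 : (0 < q)%R by exact: lt_trans pq.
pose e := (s^-1 - p^-1 + q^-1)%R.
have e0 : (0 <= e)%R.
  by rewrite addr_ge0 ?invr_ge0 ?(ltW q0)// subr_ge0 lef_pV2.
exists (C * (n.+1%:R ^+ n) `^ e)%R; first by rewrite mulr_gt0// powR_gt0 exprn_gt0.
move=> a r r0; have r20 : (0 < 2 * r)%R by rewrite mulr_gt0.
have [m mE /andP[m0 _]] := leb_Ball_fin a r0.
have mge := leb_Ball_ge a r0; rewrite mE lee_fin in mge.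
have mB t : measurable (Ball a t) := measurable_Ball a t.
pose f : T -> R := \1_(Ball a r).
have mf : measurable_fun [set: T] f by exact: measurable_indic.
have Bsub : Ball a r `<=` Ball a (2 * r)%R.
  by apply: le_Ball; rewrite ler_peMl ?(ltW r0)// ler1n.
have := HC a (2 * r)%R f r20 mf; rewrite LnrmE.
have intf g (t : R) : (0 < t)%R ->
    \int[mu]_(x in Ball a (2 * r)%R) (`|f x| `^ t * g x)%:E =
    \int[mu]_(x in Ball a r) (g x)%:E.
  move=> t0; rewrite -[in RHS](setIidr Bsub) integral_mkcondr.
  apply: eq_integral => x _; rewrite /f indicE patchE; case: ifPn => _.
    by rewrite normr1 powR1 mul1r.
  by rewrite normr0 powR0 ?gt_eqF// mul0r.
have E1 : \int[mu]_(x in Ball a (2 * r)%R) (`|f x| `^ s)%:E = m%:E.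
  rewrite -mE -[RHS]mul1e -(integral_cst mu (mB r) 1) -(intf (fun=> 1%R) s s0).
  by apply: eq_integral => x _; rewrite mulr1.
rewrite [X in X `^ _ * _ <= _]E1 [X in _ <= _ * X `^ _](intf (wpow w p) p p0).
rewrite -/(wmeas (wpow w p) _).
set X := wmeas _ _ `^ q^-1.
have J := wmeas_jensen Hw p0 pq r0 mE.
set Y := wmeas (wpow w q) (Ball a r) `^ q^-1 in J *.
move=> H; have {}H := le_trans H (lee_wpmul2l _ J).
have C20 : (0 <= C * (2 * r) `^ (n%:R * (s^-1 - p^-1 + q^-1)))%R.
  by rewrite mulr_ge0 ?powR_ge0// ltW.
rewrite lee_fin C20 in H; have {H} := H isT.
rewrite poweR_EFin => /(@lee_wpmul2l _ (m `^ (- s^-1))%:E).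
rewrite lee_fin powR_ge0 => /(_ isT).
have ms : (m `^ (- s^-1) * m `^ s^-1 = 1)%R.
  by rewrite -powRD ?addNr ?powRr0// (gt_eqF m0) implybT.
rewrite [leLHS]muleA -EFinM ms mul1e.
move=> /le_trans; apply.
rewrite [Y * _]muleC !muleA -!EFinM; apply: lee_wpmul2r; first exact: poweR_ge0.
rewrite lee_fin -/e mulrAC -powRD; last by rewrite (gt_eqF m0) implybT.
rewrite (_ : - s^-1 + (p^-1 - q^-1) = - e)%R; last by rewrite /e; ring.
rewrite mulrCA ler_pM2l// powRN mulrC ler_pdivrMr ?powR_gt0//.
rewrite -powRM ?exprn_ge0// ?(ltW m0)//.
rewrite powRrM powR_mulrn ?(ltW r20)//.
apply: ge0_ler_powR => //; rewrite ?nnegrE ?exprn_ge0 ?mulr_ge0 ?exprn_ge0 ?(ltW r0) ?(ltW m0)//.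
apply: (@le_trans _ _ (n.+1%:R ^+ n * (2 * (r / n.+1%:R)) ^+ n)%R).
  by rewrite -exprMn (_ : n.+1%:R * _ = 2 * r)%R//
    mulrCA; congr (2 * _)%R; rewrite mulrC divfK ?pnatr_eq0.
by rewrite ler_pM2l// exprn_gt0.
Qed.

End testing_consequences.

(** * Dyadic sums below an integral *)

(** The integral of a nonnegative function is a supremum over the simple
    functions below it, hence monotone for arbitrary functions. This matters
    because the integrand of the condition on psi1 and psi2 is built from an
    arbitrary psi1. *)
Lemma ge0_le_integral_nonmeasurable d (T : measurableType d) (R : realType)
    (mu : {measure set T -> \bar R}) (D : set T) (f g : T -> \bar R) :
  (forall x, D x -> 0 <= f x) -> (forall x, D x -> f x <= g x) ->
  \int[mu]_(x in D) f x <= \int[mu]_(x in D) g x.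
Proof.
move=> f0 fg; rewrite !ge0_integralE//; last first.
  by move=> x Dx; exact: le_trans (f0 x Dx) (fg x Dx).
apply: ereal_sup_le => _ [h hf <-]; exists h => // x.
apply: (le_trans (hf x)); rewrite !patchE; case: ifPn => // /set_mem Dx.
exact: fg.
Qed.

Lemma nneseries_le_single (R : realType) (f : nat -> \bar R) (b : \bar R) (k0 : nat) :
  (forall k, 0 <= f k) -> 0 <= b -> f k0 <= b -> (forall k, k != k0 -> f k = 0) ->
  \sum_(k <oo) f k <= b.
Proof.
move=> f0 b0 fb fz; apply: lime_le; first exact: is_cvg_nneseries.
apply: nearW => N; rewrite big_mkord.
have [k0N|k0N] := ltnP k0 N.
  rewrite (bigD1 (Ordinal k0N))//= big1 ?adde0// => i ik.
  exact: fz.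
rewrite big1// => i _; apply: fz.
by rewrite neq_ltn (leq_trans (ltn_ord i) k0N).
Qed.

(** On the interval from t_k = 2^(k+1) r to 2 t_k, of length t_k, the integrand
    is at least I(t_k) / (D u(t_k) * 2 t_k): the numerator increases, and the
    denominators are controlled by doubling. The corresponding step function h
    is measurable and has integral the sum divided by 2 D. *)
Lemma nneseries_dyadic_le (R : realType) (I : R -> \bar R) (u : R -> R) (D r : R) :
  (0 < r)%R -> (0 < D)%R ->
  (forall t, (0 < t)%R -> 0 <= I t) ->
  (forall t t', (0 < t)%R -> (t <= t')%R -> I t <= I t') ->
  (forall t, (0 < t)%R -> (0 < u t)%R) ->
  (forall t t', (0 < t)%R -> (t <= t')%R -> (u t <= u t')%R) ->
  (forall t, (0 < t)%R -> (u (2 * t) <= D * u t)%R) ->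
  \sum_(k <oo) (I (2 ^+ k.+1 * r)%R * (u (2 ^+ k.+1 * r))^-1%:E) <=
  (2 * D)%:E * \int[lebesgue_measure]_(t in `]r, +oo[) (I t * (u t)^-1%:E * t^-1%:E).
Proof.
move=> r0 D0 I0 Imon u0 umon uD.
pose t_ k := (2 ^+ k.+1 * r)%R.
have t0 k : (0 < t_ k)%R by rewrite mulr_gt0// exprn_gt0.
have tS k : (2 * t_ k = t_ k.+1)%R by rewrite /t_ mulrA -exprS.
have tmon j k : (j <= k)%N -> (t_ j <= t_ k)%R.
  by move=> jk; rewrite ler_pM2r// ler_weXn2l// ler1n.
pose E_ k : set R := `[t_ k, t_ k.+1[%classic.
pose c k := I (t_ k) * ((D * u (t_ k))^-1 * (2 * t_ k)^-1)%:E.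
have v0 k : (0 <= (D * u (t_ k))^-1 * (2 * t_ k)^-1)%R.
  by rewrite mulr_ge0// invr_ge0 mulr_ge0// ltW// u0.
have c0 k : 0 <= c k by rewrite mule_ge0 ?I0// lee_fin.
have rt k : (r < t_ k)%R by rewrite ltr_pMl// exprn_egt1// ltr1n.
have rpos (t : R) : `]r, +oo[%classic t -> (0 < t)%R.
  by rewrite /= in_itv/= andbT; exact: lt_trans.
have sub k : E_ k `<=` `]r, +oo[%classic.
  by move=> t; rewrite /E_ /= !in_itv/= andbT => /andP[/(lt_le_trans (rt k))].
have mE k : measurable (E_ k) by exact: measurable_itv.
have mik k : measurable_fun (`]r, +oo[%classic : set R)
    (fun t => (\1_(E_ k) t)%:E).
  by apply/measurable_EFinP; exact: measurable_indic.
have mfk k : measurable_fun (`]r, +oo[%classic : set R)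
    (fun t => c k * (\1_(E_ k) t)%:E) by exact: measurable_funeM.
pose h (t : R) : \bar R := \sum_(k <oo) (c k * (\1_(E_ k) t)%:E).
have h0 k t : 0 <= c k * (\1_(E_ k) t)%:E by rewrite mule_ge0// lee_fin.
have hg t : `]r, +oo[%classic t -> h t <= I t * (u t)^-1%:E * t^-1%:E.
  move=> /rpos tpos.
  have g0 : 0 <= I t * (u t)^-1%:E * t^-1%:E.
    by rewrite !mule_ge0 ?I0// lee_fin invr_ge0 ltW// u0.
  have [[k0 Ek0]|noE] := pselect (exists k, E_ k t); last first.
    apply: (@nneseries_le_single _ _ _ 0%N) => //.
      by rewrite indicE memNset ?mule0// => H; apply: noE; exists 0%N.
    by move=> k _; rewrite indicE memNset ?mule0// => H; apply: noE; exists k.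
  apply: (@nneseries_le_single _ _ _ k0) => //.
    rewrite indicE mem_set// mule1 /c EFinM muleA.
    move: Ek0; rewrite /E_ /= in_itv/= => /andP[tk tk1].
    apply: lee_pmul => //.
    - by rewrite mule_ge0 ?I0// lee_fin invr_ge0 mulr_ge0// ltW// u0.
    - by rewrite lee_fin invr_ge0 mulr_ge0// ltW.
    - apply: lee_pmul; rewrite ?I0//.
      + by rewrite lee_fin invr_ge0 mulr_ge0// ltW// u0.
      + exact: Imon.
      + rewrite lee_fin lef_pV2 ?posrE ?mulr_gt0 ?u0//.
        by apply: le_trans (uD _ (t0 k0)); apply: umon => //; rewrite tS ltW.
    - by rewrite lee_fin lef_pV2 ?posrE ?mulr_gt0 ?u0// tS ltW.
  move=> k kk0; rewrite indicE memNset ?mule0// => Ek.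
  move: Ek0 Ek; rewrite /E_ /= !in_itv/= => /andP[tk0 tk01] /andP[tk tk1].
  move: kk0; rewrite neq_ltn => /orP[|] lt.
    have := lt_le_trans tk1 (tmon _ _ lt).
    by move=> /lt_le_trans /(_ tk0); rewrite ltxx.
  have := lt_le_trans tk01 (tmon _ _ lt).
  by move=> /lt_le_trans /(_ tk); rewrite ltxx.
have hint : \int[lebesgue_measure]_(t in `]r, +oo[) h t =
    \sum_(k <oo) (c k * (t_ k)%:E).
  rewrite /h integral_nneseries//; apply: eq_eseriesr => k _.
  rewrite ge0_integralZl//; last first.
    exact: mik.
  congr (_ * _); rewrite integral_indic//; last exact: measurable_itv.
  rewrite (_ : _ `&` _ = E_ k); last exact: (setIidl (sub k)).
  apply: (etrans (lebesgue_measure_itv _)); rewrite /= lte_fin -tS.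
  by rewrite ltr_pMl// ltr1n -EFinB; congr (_%:E); ring.
apply: (@le_trans _ _ ((2 * D)%:E * \int[lebesgue_measure]_(t in `]r, +oo[) h t)).
  rewrite hint -nneseriesZl; last by move=> k _; rewrite mule_ge0// lee_fin ltW.
  apply: lee_nneseries => [k _ _|k _].
    by apply: mule_ge0; [exact: (I0 _ (t0 k))|rewrite lee_fin invr_ge0 ltW// (u0 _ (t0 k))].
  rewrite /c -muleA -EFinM muleCA -EFinM le_eqVlt; apply/orP; left; apply/eqP.
  congr (_ * _%:E); rewrite -/(t_ k).
  by field; rewrite !gt_eqF ?u0.
apply: lee_wpmul2l; first by rewrite lee_fin mulr_ge0// ltW.
apply: ge0_le_integral_nonmeasurable => // t _.
by apply: nneseries_ge0.
Qed.

(** * The local estimate in Morrey spaces *)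

Section morrey.
Context (R : realType) (n : nat).
Local Notation T := (Rn R n).
Local Notation mu := (leb R n).
Variables (alpha p q s : R) (w1 w2 : T -> R) (psi1 psi2 : T -> R -> R).
Variables (u : T -> R -> R) (D C : R).
Hypothesis Hw1 : ae_positive w1.
Hypotheses (p0 : (0 < p)%R) (s0 : (0 < s)%R) (n0 : (0 < n)%N).
Hypothesis hq : (q^-1 = p^-1 - alpha / n%:R)%R.
Hypothesis D0 : (0 < D)%R.
Hypothesis C0 : (0 < C)%R.
Hypothesis HC : testing_ineq p q s w1 w2 C.
(* The measures of balls for w2 ^ q are finite; the real-valued radial function
   u, their power 1/q, makes divisions harmless. *)
Hypothesis uE : forall a t, (0 < t)%R ->
  wmeas (wpow w2 q) (Ball a t) `^ q^-1 = (u a t)%:E.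
Hypothesis u_gt0 : forall a t, (0 < t)%R -> (0 < u a t)%R.
Hypothesis u_mon : forall a t t', (0 < t)%R -> (t <= t')%R -> (u a t <= u a t')%R.
Hypothesis u_dbl : forall a t, (0 < t)%R -> (u a (2 * t) <= D * u a t)%R.
Hypotheses (hpsi1 : forall a r, (0 < r)%R -> (0 < psi1 a r)%R)
  (hpsi2 : forall a r, (0 < r)%R -> (0 < psi2 a r)%R)
  (hpsi : psi_condition p q w1 w2 psi1 psi2).

Definition inf_tail (a : T) (t : R) : \bar R :=
  ereal_inf [set (psi1 a l)%:E * wmeas (wpow w1 p) (Ball a l) `^ p^-1
            | l in [set l : R | (t <= l)%R]].

Lemma inf_tail_ge0 a t : (0 < t)%R -> 0 <= inf_tail a t.
Proof.
move=> t0; apply: le_ereal_inf_tmp => _ [l /= tl <-].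
by rewrite mule_ge0 ?poweR_ge0// lee_fin ltW// hpsi1// (lt_le_trans t0).
Qed.

Lemma inf_tail_mon a t t' : (t <= t')%R -> inf_tail a t <= inf_tail a t'.
Proof.
move=> tt'; apply: ereal_inf_le_tmp => _ [l /= tl <-].
by exists l => //=; exact: le_trans tl.
Qed.

Lemma psi_condition_sum : exists2 K : R, (0 < K)%R & forall a r, (0 < r)%R ->
  \sum_(k <oo) (inf_tail a (2 ^+ k.+1 * r)%R * (u a (2 ^+ k.+1 * r))^-1%:E) <=
  (K * psi2 a r)%:E.
Proof.
move: hpsi; rewrite /psi_condition; set A := ereal_sup _ => Aoo.
pose J a r := \int[lebesgue_measure]_(t in `]r, +oo[)
  (inf_tail a t * (u a t)^-1%:E * t^-1%:E).
have J0 a r : (0 < r)%R -> 0 <= J a r.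
  move=> r0; apply: integral_ge0 => t; rewrite /= in_itv/= andbT => rt.
  have t0 := lt_trans r0 rt.
  by rewrite !mule_ge0 ?inf_tail_ge0// lee_fin invr_ge0 ltW// u_gt0.
have JA a r : (0 < r)%R -> (psi2 a r)^-1%:E * J a r <= A.
  move=> r0; apply: ereal_sup_ubound; exists (a, r) => //=.
  congr (_ * _); apply: eq_integral => t; rewrite inE/= in_itv/= andbT => rt.
  have t0 := lt_trans r0 rt.
  by rewrite uE// inver gt_eqF// u_gt0.
have A0 : 0 <= A.
  apply: (le_trans _ (JA point 1%R ltr01)).
  by rewrite mule_ge0 ?J0// lee_fin invr_ge0 ltW// hpsi2.
have Afin : A \is a fin_num by rewrite ge0_fin_numE.
exists (2 * D * (fine A + 1))%R.
  by rewrite mulr_gt0 ?mulr_gt0// ltr_wpDl// fine_ge0.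
move=> a r r0.
apply: (le_trans (nneseries_dyadic_le r0 D0 (@inf_tail_ge0 a)
  (fun t t' _ => @inf_tail_mon a t t') (u_gt0 a) (u_mon a) (u_dbl a))).
rewrite -/(J a r) -!mulrA EFinM [leRHS]EFinM -muleA.
apply: lee_wpmul2l; first by rewrite lee_fin.
rewrite EFinM; apply: lee_wpmul2l; first by rewrite lee_fin ltW.
have ps := hpsi2 a r0.
have -> : J a r = (psi2 a r)%:E * ((psi2 a r)^-1%:E * J a r).
  by rewrite muleA -EFinM divff ?gt_eqF// mul1e.
rewrite [X in _ <= X%:E]mulrC EFinM; apply: lee_wpmul2l; first by rewrite lee_fin ltW.
by apply: (le_trans (JA a r r0)); rewrite EFinD fineK// leeDl// lee_fin.
Qed.

Lemma morrey_nrm_ge0 (f : T -> \bar R) : 0 <= morrey_nrm p (wpow w1 p) psi1 f.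
Proof.
apply: le_ereal_sup_tmp; exists ((psi1 point 1)^-1%:E *
  (wmeas (wpow w1 p) (Ball point 1%R) `^ p^-1)^-1 *
  Lnrm p (wpow w1 p) (Ball point 1%R) f); first by exists (point, 1%R) => /=.
by rewrite !mule_ge0 ?inve_ge0 ?poweR_ge0// lee_fin invr_ge0 ltW// hpsi1.
Qed.

(** Local integrability of w1 ^ p comes from the condition on psi1 and psi2: from
    the finiteness of the integral against I, which rules out that the infimum
    over arbitrarily large radii be infinite. *)
Lemma wmeas_w1_fin a r : (0 < r)%R -> wmeas (wpow w1 p) (Ball a r) < +oo.
Proof.
move=> r0; have [K K0 /(_ a r r0)] := psi_condition_sum.
have r20 : (0 < 2 * r)%R by rewrite mulr_gt0.
have term0 k : 0 <= inf_tail a (2 ^+ k.+1 * r)%R * (u a (2 ^+ k.+1 * r))^-1%:E.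
  have t0 : (0 < 2 ^+ k.+1 * r)%R by rewrite mulr_gt0// exprn_gt0.
  by rewrite mule_ge0 ?inf_tail_ge0// lee_fin invr_ge0 ltW// u_gt0.
rewrite nneseries_recl// => sumK.
have : inf_tail a (2 * r)%R * (u a (2 * r))^-1%:E < +oo.
  apply: le_lt_trans (ltry (K * psi2 a r)); apply: le_trans sumK.
  by rewrite expr1 leeDl// nneseries_ge0.
have [Ioo|Ioo _] := eqVneq (inf_tail a (2 * r)%R) +oo.
  by rewrite Ioo gt0_mulye// lte_fin invr_gt0 u_gt0.
have /ereal_inf_lt[_ [l /= rl <-]] : inf_tail a (2 * r)%R < +oo by rewrite ltey.
have l0 : (0 < l)%R by exact: lt_le_trans rl.
have [mw w0 _] := ae_positive_wpow p Hw1.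
move=> Hl; apply: (@le_lt_trans _ _ (wmeas (wpow w1 p) (Ball a l))).
  by apply: le_wmeas_Ball => //; apply: le_trans rl; rewrite ler_peMl ?(ltW r0)// ler1n.
apply: (@lty_poweRy _ _ p^-1); first by rewrite gt_eqF// invr_gt0.
rewrite ltey; apply/eqP => Eoo; move: Hl.
by rewrite Eoo gt0_muley ?lte_fin ?hpsi1// ltxx.
Qed.

Lemma le_Lnrm (w : T -> R) (E F : set T) (f : T -> R) :
  measurable_fun [set: T] w -> (forall x, (0 <= w x)%R) ->
  measurable_fun [set: T] f -> measurable E -> measurable F -> E `<=` F ->
  Lnrm p w E (EFin \o f) <= Lnrm p w F (EFin \o f).
Proof.
move=> mw w0 mf mE mF EF; rewrite !LnrmE; apply: lee_poweR.
- by rewrite invr_ge0 ltW.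
- by apply: integral_ge0 => x _; rewrite lee_fin mulr_ge0 ?powR_ge0.
exact: subset_integral_powM.
Qed.

(** The bound by M psi1(a, l) w1^p(B(a, l))^(1/p) holds for every l >= t because
    the ball only grows; then take the infimum over l. Dividing by the measure
    of the ball requires it to be positive and finite. *)
Lemma morrey_Lnrm_le (f : T -> R) (m : R) a t :
  measurable_fun [set: T] f ->
  morrey_nrm p (wpow w1 p) psi1 (EFin \o f) = m%:E -> (0 < t)%R ->
  Lnrm p (wpow w1 p) (Ball a t) (EFin \o f) <= m%:E * inf_tail a t.
Proof.
move=> mf fm t0.
have [mw w0 _] := ae_positive_wpow p Hw1.
have mB r : measurable (Ball a r) := measurable_Ball a r.
have L0 r : 0 <= Lnrm p (wpow w1 p) (Ball a r) (EFin \o f) by exact: poweR_ge0.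
have H l : (t <= l)%R -> Lnrm p (wpow w1 p) (Ball a t) (EFin \o f) <=
    m%:E * ((psi1 a l)%:E * wmeas (wpow w1 p) (Ball a l) `^ p^-1).
  move=> tl; have l0 : (0 < l)%R by exact: lt_le_trans tl.
  apply: (le_trans (le_Lnrm mw w0 mf (mB t) (mB l) (le_Ball tl))).
  have W0 := wmeas_Ball_gt0 a (ae_positive_wpow p Hw1) l0.
  set W := wmeas _ _ `^ _.
  have Wgt : 0 < W by exact: poweR_gt0.
  have Wf : W \is a fin_num.
    by rewrite gt0_fin_numE//; apply: poweR_lty; exact: wmeas_w1_fin.
  have : (psi1 a l)^-1%:E * W^-1 * Lnrm p (wpow w1 p) (Ball a l) (EFin \o f) <= m%:E.
    by rewrite -fm; apply: ereal_sup_ubound; exists (a, l).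
  move: Wgt; rewrite -(fineK Wf); move: (fine W) => v v0.
  rewrite lte_fin in v0.
  rewrite inver gt_eqF// -!EFinM => Hm.
  have c0 : (0 < psi1 a l * v)%R by rewrite mulr_gt0// hpsi1.
  have := lee_wpmul2r (_ : 0 <= (psi1 a l * v)%:E) Hm.
  rewrite lee_fin (ltW c0) => /(_ isT) {}Hm.
  apply: (le_trans _ (le_trans Hm _)); last by rewrite -!EFinM.
  by rewrite muleAC -EFinM -invfM mulVf ?gt_eqF// mul1e.
have m0 : (0 <= m)%R by rewrite -lee_fin -fm morrey_nrm_ge0.
have [mz|mz] := eqVneq m 0%R.
  by have := H t (lexx t); rewrite mz !mul0e.
have mgt : (0 < m)%R by rewrite lt_neqAle eq_sym mz.
rewrite -lee_pdivrMl//; apply: le_ereal_inf_tmp => _ [l /= tl <-].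
by rewrite lee_pdivrMl//; exact: H.
Qed.

Variables (S : @operator R n) (NB : set T -> (T -> \bar R) -> \bar R) (KB : R).
Hypothesis hS : sublinear S.
Hypothesis hsize : size_condition alpha s S.
Hypothesis KB0 : (0 < KB)%R.
(* The target functional N_B(h), which is L^q or weak L^q of the ball, is only
   required to be controlled by the global norm of h1 and the sup k of h2. *)
Hypothesis NB_split : forall a r (h h1 h2 : T -> \bar R) (k : R), (0 < r)%R ->
  measurable_fun [set: T] h -> measurable_fun [set: T] h1 ->
  {ae mu, forall x, `|h x| <= `|h1 x| + `|h2 x|} ->
  (0 <= k)%R -> (forall x, Ball a r x -> `|h2 x| <= k%:E) ->
  NB (Ball a r) h <= KB%:E * (NB [set: T] h1 + (k * u a r)%:E).

(** Each term of the size condition is rewritten with the testing inequality,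
    whose power of the radius cancels that of the term. *)
Lemma size_condition_morrey : exists2 K : R, (0 < K)%R &
  forall (f : T -> R) (m : R) a r, (0 < r)%R ->
  measurable_fun [set: T] f ->
  morrey_nrm p (wpow w1 p) psi1 (EFin \o f) = m%:E ->
  forall x, Ball a r x ->
  `|S (f \* \1_(~` Ball a (2 * r)))%R x| <=
   K%:E * (m%:E * \sum_(1 <= k <oo)
     (inf_tail a (2 ^+ k.+1 * r)%R * (u a (2 ^+ k.+1 * r))^-1%:E)).
Proof.
have [Cs [Cs0 Hs]] := hsize.
exists (Cs * C)%R; first by rewrite mulr_gt0.
move=> f m a r r0 mf fm x Bx.
have t0 k : (0 < 2 ^+ k.+1 * r)%R by rewrite mulr_gt0// exprn_gt0.
have m0 : (0 <= m)%R by rewrite -lee_fin -fm morrey_nrm_ge0.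
have I0 k : 0 <= inf_tail a (2 ^+ k.+1 * r)%R by exact: inf_tail_ge0.
have Iu0 k : 0 <= inf_tail a (2 ^+ k.+1 * r)%R * (u a (2 ^+ k.+1 * r))^-1%:E.
  by rewrite mule_ge0// lee_fin invr_ge0 ltW// u_gt0.
apply: (le_trans _ (le_trans (Hs f a r mf r0) _)).
  by apply: ereal_sup_ubound; exists x.
rewrite EFinM -muleA; apply: lee_wpmul2l; first by rewrite lee_fin ltW.
rewrite -!nneseriesZl//; last by move=> k _; rewrite mule_ge0// lee_fin.
apply: lee_nneseries => [k _ _|k _].
  by rewrite mule_ge0 ?poweR_ge0// lee_fin powR_ge0.
have := HC a (t0 k) mf; rewrite [X in _ * X <= _](uE a (t0 k)).
set X := _ `^ s^-1; set t := (2 ^+ k.+1 * r)%R.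
have ut0 : (0 < u a t)%R := u_gt0 a (t0 k).
have L := morrey_Lnrm_le a mf fm (t0 k).
rewrite -/t in L *.
have -> : (n%:R * (s^-1 - p^-1 + q^-1) = - (- (n%:R / s) + alpha))%R.
  by rewrite hq; field; rewrite !gt_eqF// ltr0n.
set e := (- (n%:R / s) + alpha)%R => H.
have {L}H := le_trans H (lee_wpmul2l _ L).
rewrite lee_fin mulr_ge0 ?powR_ge0 ?(ltW C0)// in H; have {}H := H isT.
have te0 : (0 < t `^ e)%R by rewrite powR_gt0// t0.
have := lee_wpmul2l (_ : 0 <= (t `^ e / u a t)%:E) H.
rewrite lee_fin divr_ge0 ?(ltW te0) ?(ltW ut0)// => /(_ isT) {}H.
apply: (le_trans (le_trans _ H)).
  rewrite [X * _]muleC muleA -EFinM divfK ?gt_eqF//.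
rewrite muleA -EFinM powRN.
rewrite (_ : (t `^ e / u a t * (C / t `^ e) = C * (u a t)^-1)%R); last first.
  by field; rewrite !gt_eqF.
rewrite EFinM -muleA; apply: lee_wpmul2l; first by rewrite lee_fin ltW.
by rewrite muleCA [X in _ <= _ * X]muleC.
Qed.

Lemma local_part_le (f : T -> R) (m : R) a r : (0 < r)%R ->
  measurable_fun [set: T] f ->
  morrey_nrm p (wpow w1 p) psi1 (EFin \o f) = m%:E ->
  Lnrm p (wpow w1 p) [set: T] (EFin \o (f \* \1_(Ball a (2 * r)))%R) <=
  m%:E * inf_tail a (2 * r)%R.
Proof.
move=> r0 mf fm; have r20 : (0 < 2 * r)%R by rewrite mulr_gt0.
have L := morrey_Lnrm_le a mf fm r20.
apply: le_trans L; rewrite !LnrmE le_eqVlt; apply/orP; left; apply/eqP.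
exact: (congr1 (fun z => z `^ p^-1) (integral_powM_restrict mu _ f (wpow w1 p) p0)).
Qed.

(** The local part f1 is handled by the boundedness of S and the first dyadic
    term, the far part f2 by the remaining ones. *)
Lemma bounded_morrey :
  bounded_op S (Lnrm p (wpow w1 p) [set: T]) (NB [set: T]) ->
  bounded_op S (morrey_nrm p (wpow w1 p) psi1)
    (fun h => ereal_sup [set (psi2 z.1 z.2)^-1%:E *
        (wmeas (wpow w2 q) (Ball z.1 z.2) `^ q^-1)^-1 * NB (Ball z.1 z.2) h
      | z in [set z : T * R | (0 < z.2)%R]]).
Proof.
move=> [C1 [C10 HS]]; have [mS Sadd _] := hS.
have [K2 K20 HK2] := size_condition_morrey.
have [K K0 HK] := psi_condition_sum.
pose A := (KB * (C1 * K * D + K2 * K))%R.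
have A0 : (0 < A)%R by rewrite !(mulr_gt0, addr_gt0).
suff main (f : T -> R) (m : R) : measurable_fun [set: T] f ->
    morrey_nrm p (wpow w1 p) psi1 (EFin \o f) = m%:E ->
    ereal_sup [set (psi2 z.1 z.2)^-1%:E *
        (wmeas (wpow w2 q) (Ball z.1 z.2) `^ q^-1)^-1 * NB (Ball z.1 z.2) (S f)
      | z in [set z : T * R | (0 < z.2)%R]] <= A%:E * m%:E.
  exists A; split; first exact: A0.
  move=> f [mEf fin].
  have mf : measurable_fun [set: T] f by apply/measurable_EFinP.
  have Nf : morrey_nrm p (wpow w1 p) psi1 (EFin \o f) \is a fin_num.
    by rewrite ge0_fin_numE// morrey_nrm_ge0.
  have H := main f _ mf (esym (fineK Nf)).
  rewrite (fineK Nf) in H; split; last exact: H.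
  split; first exact: mS.
  by apply: (le_lt_trans H); rewrite -(fineK Nf) -EFinM ltry.
move=> mf fm; apply: ge_ereal_sup => _ [[a r] /= r0 <-].
have m0 : (0 <= m)%R by rewrite -lee_fin -fm morrey_nrm_ge0.
have t0 k : (0 < 2 ^+ k.+1 * r)%R by rewrite mulr_gt0// exprn_gt0.
have r20 : (0 < 2 * r)%R by rewrite mulr_gt0.
have Iu0 k : 0 <= inf_tail a (2 ^+ k.+1 * r)%R * (u a (2 ^+ k.+1 * r))^-1%:E.
  by rewrite mule_ge0 ?inf_tail_ge0// lee_fin invr_ge0 ltW// u_gt0.
have := HK a r r0; rewrite nneseries_recl// expr1.
set I2 := inf_tail a (2 * r)%R; set Sig := \sum_(1 <= k <oo) _ => sumK.
have Sig0 : 0 <= Sig by apply: nneseries_ge0.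
have I20 : 0 <= I2 by exact: inf_tail_ge0.
have u2 := u_gt0 a r20; have u1 := u_gt0 a r0; have ps := hpsi2 a r0.
have I2le : I2 <= (K * psi2 a r * D * u a r)%:E.
  have H : I2 * (u a (2 * r))^-1%:E <= (K * psi2 a r)%:E.
    by apply: le_trans sumK; rewrite leeDl.
  have {H} := lee_wpmul2r (_ : 0 <= (u a (2 * r))%:E) H.
  rewrite lee_fin (ltW u2) -muleA -EFinM mulVf ?gt_eqF// mule1 => /(_ isT) H.
  apply: (le_trans H); rewrite -EFinM lee_fin -mulrA ler_pM2l ?mulr_gt0//.
  exact: u_dbl.
have Sigle : Sig <= (K * psi2 a r)%:E.
  by apply: le_trans sumK; rewrite leeDr// mule_ge0// lee_fin invr_ge0 ltW.
pose B2 := Ball a (2 * r)%R.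
have mB2 : measurable B2 := measurable_Ball a (2 * r)%R.
pose f1 := (f \* \1_B2)%R; pose f2 := (f \* \1_(~` B2))%R.
have mf1 : measurable_fun [set: T] f1.
  by apply: measurable_funM; [exact: mf|exact: measurable_indic].
have mf2 : measurable_fun [set: T] f2.
  apply: measurable_funM; first exact: mf.
  by apply: measurable_indic; exact: measurableC.
have fE : f = (f1 \+ f2)%R.
  apply/funext => x; rewrite /f1 /f2 /= !indicE in_setC.
  by case: (x \in B2); rewrite /= ?mulr1 ?mulr0 ?addr0 ?add0r.
have L1 := local_part_le a r0 mf fm.
have L1' : Lnrm p (wpow w1 p) [set: T] (EFin \o f1) <=
    (m * (K * psi2 a r * D * u a r))%:E.
  by apply: (le_trans L1); rewrite [leRHS]EFinM; apply: lee_wpmul2l; rewrite ?lee_fin.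
have [_ N1] : Defs.space (NB [set: T]) (S f1) /\
    NB [set: T] (S f1) <= C1%:E * Lnrm p (wpow w1 p) [set: T] (EFin \o f1).
  apply: HS; split; first by apply/measurable_EFinP.
  exact: le_lt_trans L1' (ltry _).
pose k := (K2 * (m * (K * psi2 a r)))%R.
have k0 : (0 <= k)%R by rewrite !mulr_ge0 ?(ltW K20) ?(ltW K0) ?(ltW ps).
have Hk x : Ball a r x -> `|S f2 x| <= k%:E.
  move=> Bx; apply: (le_trans (HK2 f m a r r0 mf fm x Bx)).
  rewrite -/Sig /k EFinM; apply: lee_wpmul2l; first by rewrite lee_fin ltW.
  by rewrite EFinM; apply: lee_wpmul2l; rewrite ?lee_fin.
have Hadd : {ae mu, forall x, `|S f x| <= `|S f1 x| + `|S f2 x|}.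
  by rewrite [in S f]fE; exact: Sadd.
have := NB_split r0 (mS f mf) (mS f1 mf1) Hadd k0 Hk.
have N1' : NB [set: T] (S f1) <= (C1 * (m * (K * psi2 a r * D * u a r)))%:E.
  by apply: (le_trans N1); rewrite [leRHS]EFinM; apply: lee_wpmul2l; rewrite ?lee_fin ?(ltW C10).
move=> /le_trans /(_ (lee_wpmul2l _ (leeD2r _ N1'))).
rewrite lee_fin (ltW KB0) => /(_ isT); rewrite -EFinD -EFinM => HN.
rewrite uE// inver gt_eqF// -EFinM.
apply: (@le_trans _ _ (((psi2 a r)^-1 / u a r)%:E *
   (KB * (C1 * (m * (K * psi2 a r * D * u a r)) + k * u a r))%:E)).
  by apply: lee_wpmul2l => //; rewrite lee_fin mulr_ge0 ?invr_ge0 ?(ltW ps) ?(ltW u1).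
rewrite -!EFinM lee_fin le_eqVlt; apply/orP; left; apply/eqP.
by rewrite /A /k; field; rewrite !gt_eqF.
Qed.

End morrey.

(** * Splitting the strong and the weak norm *)

(** Compare x + y with twice the larger of the two terms; this weak form of
    convexity is valid for every exponent t >= 0. *)
Lemma poweRD_le (R : realType) (x y : \bar R) (t : R) : (0 <= t)%R ->
  0 <= x -> 0 <= y -> (x + y) `^ t <= (2%:E * x) `^ t + (2%:E * y) `^ t.
Proof.
move=> t0 x0 y0.
have two (z : \bar R) : 0 <= z -> 2%:E * z = z + z.
  by move=> z0; rewrite -[2%R]/(1 + 1)%R EFinD ge0_muleDl// mul1e.
have [xy|/ltW yx] := leP x y.
  apply: (@le_trans _ _ ((2%:E * y) `^ t)); last by rewrite leeDr// poweR_ge0.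
  by apply: lee_poweR => //; rewrite ?adde_ge0// two// leeD2r.
apply: (@le_trans _ _ ((2%:E * x) `^ t)); last by rewrite leeDl// poweR_ge0.
by apply: lee_poweR => //; rewrite ?adde_ge0// two// leeD2l.
Qed.

Section split_norms.
Context d (T : measurableType d) (R : realType) (mu : {measure set T -> \bar R}).
Implicit Types (B : set T) (h : T -> \bar R) (v : T -> R).

Lemma integral_powR_split B h h1 h2 v (q k : R) : measurable B -> (0 < q)%R ->
  measurable_fun [set: T] h -> measurable_fun [set: T] h1 ->
  measurable_fun [set: T] v -> (forall x, (0 <= v x)%R) -> (0 <= k)%R ->
  {ae mu, forall x, `|h x| <= `|h1 x| + `|h2 x|} ->
  (forall x, B x -> `|h2 x| <= k%:E) ->
  (\int[mu]_(x in B) (`|h x| `^ q * (v x)%:E)) `^ q^-1 <=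
  (2 * 2 `^ q^-1)%:E * ((\int[mu]_x (`|h1 x| `^ q * (v x)%:E)) `^ q^-1 +
    k%:E * (\int[mu]_(x in B) (v x)%:E) `^ q^-1).
Proof.
move=> mB q0 mh mh1 mv v0 k0 hle h2k.
have mpow g : measurable_fun [set: T] g ->
    measurable_fun [set: T] (fun x => `|g x| `^ q * (v x)%:E).
  move=> mg; apply: emeasurable_funM; last by apply/measurable_EFinP.
  apply: (measurableT_comp (measurable_poweR q)).
  exact: (measurableT_comp (@abse_measurable R setT)).
have pos g x : 0 <= `|g x| `^ q * (v x)%:E.
  by rewrite mule_ge0 ?poweR_ge0// lee_fin.
have mvE D : measurable_fun D (EFin \o v).
  by apply/measurable_EFinP; exact: measurable_funTS.
have I1 : \int[mu]_(x in B) (`|h x| `^ q * (v x)%:E) <=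
    (2 `^ q)%:E * \int[mu]_x (`|h1 x| `^ q * (v x)%:E) +
    ((2 * k) `^ q)%:E * \int[mu]_(x in B) (v x)%:E.
  apply: (@le_trans _ _ (\int[mu]_(x in B)
     ((2 `^ q)%:E * (`|h1 x| `^ q * (v x)%:E) + ((2 * k) `^ q)%:E * (v x)%:E))).
    apply: ae_ge0_le_integral => //.
    - by apply: measurable_funTS; exact: mpow.
    - by move=> x _; rewrite adde_ge0// mule_ge0// lee_fin ?powR_ge0.
    - apply: emeasurable_funD.
        by apply: measurable_funeM; apply: measurable_funTS; exact: mpow.
      by apply: measurable_funeM; exact: mvE.
    apply: filterS hle => x hx Bx.
    rewrite muleA -ge0_muleDl; last 2 first.
    - by rewrite mule_ge0 ?poweR_ge0// lee_fin powR_ge0.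
    - by rewrite lee_fin powR_ge0.
    apply: lee_wpmul2r; first by rewrite lee_fin.
    have hk : `|h x| <= `|h1 x| + k%:E.
      by apply: (le_trans hx); rewrite leeD2l// h2k.
    apply: (le_trans (lee_poweR (ltW q0) (abse_ge0 _) hk)).
    apply: (le_trans (poweRD_le (ltW q0) (abse_ge0 _) _)); first by rewrite lee_fin.
    by rewrite poweRM// -EFinM !poweR_EFin.
  rewrite ge0_integralD//; last 4 first.
  - by move=> x _; rewrite mule_ge0// lee_fin powR_ge0.
  - by apply: measurable_funeM; apply: measurable_funTS; exact: mpow.
  - by move=> x _; rewrite mule_ge0// lee_fin ?powR_ge0.
  - by apply: measurable_funeM; exact: mvE.
  rewrite ge0_integralZl//; last by apply: measurable_funTS; exact: mpow.
  rewrite ge0_integralZl//; last 2 first.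
  - by move=> x _; rewrite lee_fin.
  - by rewrite lee_fin powR_ge0.
  apply: leeD => //; apply: lee_wpmul2l; first by rewrite lee_fin powR_ge0.
  by apply: ge0_subset_integral => //; exact: mpow.
have q1 : (0 <= q^-1)%R by rewrite invr_ge0 ltW.
have qq : (q * q^-1 = 1)%R by rewrite divff// gt_eqF.
have X0 : 0 <= \int[mu]_x (`|h1 x| `^ q * (v x)%:E) by exact: integral_ge0.
have V0 : 0 <= \int[mu]_(x in B) (v x)%:E.
  by apply: integral_ge0 => x _; rewrite lee_fin.
have c0 c : 0 <= (c `^ q)%:E by rewrite lee_fin powR_ge0.
apply: (le_trans (lee_poweR q1 _ I1)); first exact: integral_ge0.
apply: (le_trans (poweRD_le q1 _ _)); rewrite ?mule_ge0//.
rewrite !poweRM ?mule_ge0//.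
rewrite !poweR_EFin -!powRrM qq !powRr1 ?mulr_ge0//.
rewrite ge0_muleDr ?mule_ge0 ?poweR_ge0// !muleA -!EFinM.
by rewrite [(2 * 2 `^ _)%R]mulrC -mulrA.
Qed.

Lemma ae_subset_integral (A B : set T) v : measurable A -> measurable B ->
  measurable_fun [set: T] v -> (forall x, (0 <= v x)%R) ->
  {ae mu, forall x, A x -> B x} ->
  \int[mu]_(x in A) (v x)%:E <= \int[mu]_(x in B) (v x)%:E.
Proof.
move=> mA mB mv v0 AB; rewrite integral_mkcond [leRHS]integral_mkcond.
have mp D : measurable D -> measurable_fun [set: T] ((EFin \o v) \_ D).
  move=> mD; apply/(measurable_restrictT _ mD).
  by apply/measurable_EFinP; exact: measurable_funTS.
have p0 D x : 0 <= ((EFin \o v) \_ D) x.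
  by rewrite patchE; case: ifPn => // _; rewrite lee_fin.
apply: ae_ge0_le_integral => //; [exact: mp|exact: mp|].
apply: filterS AB => x ABx _; rewrite !patchE.
case: ifPn => [/set_mem/ABx Bx|_]; first by rewrite mem_set.
by case: ifPn => // _; rewrite lee_fin.
Qed.

(** If c / 2 <= k the bound is that of the whole of B. Otherwise |h2| < c / 2 on
    B, so that |h| > c forces |h1| > c / 2. *)
Lemma weak_level_split B h h1 h2 v (q k c : R) : measurable B -> (0 < q)%R ->
  measurable_fun [set: T] h -> measurable_fun [set: T] h1 ->
  measurable_fun [set: T] v -> (forall x, (0 <= v x)%R) ->
  (0 <= k)%R -> (0 < c)%R ->
  {ae mu, forall x, `|h x| <= `|h1 x| + `|h2 x|} ->
  (forall x, B x -> `|h2 x| <= k%:E) ->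
  c%:E * (\int[mu]_(x in B `&` [set x | c%:E < `|h x|]) (v x)%:E) `^ q^-1 <=
  2%:E * ((c / 2)%:E * (\int[mu]_(x in setT `&` [set x | (c / 2)%:E < `|h1 x|]) (v x)%:E) `^ q^-1 +
    k%:E * (\int[mu]_(x in B) (v x)%:E) `^ q^-1).
Proof.
move=> mB q0 mh mh1 mv v0 k0 c0 hle h2k.
have q1 : (0 <= q^-1)%R by rewrite invr_ge0 ltW.
have mlev g (t : R) : measurable_fun [set: T] g ->
    measurable [set x | t%:E < `|g x|].
  move=> mg; rewrite -[X in measurable X]setTI.
  apply: emeasurable_fun_o_infty => //.
  exact: (measurableT_comp (@abse_measurable R setT)).
have W0 E : 0 <= \int[mu]_(x in E) (v x)%:E by apply: integral_ge0 => x _; rewrite lee_fin.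
have c20 : (0 < c / 2)%R by rewrite divr_gt0.
have [ck|kc] := leP (c / 2)%R k.
  apply: (@le_trans _ _ (2%:E * (k%:E * (\int[mu]_(x in B) (v x)%:E) `^ q^-1))); last first.
    by apply: lee_wpmul2l => //; rewrite leeDr// mule_ge0 ?poweR_ge0// lee_fin ltW.
  rewrite muleA; apply: lee_pmul; rewrite ?poweR_ge0//.
  - by rewrite lee_fin ltW.
  - by rewrite -EFinM lee_fin mulrC -ler_pdivrMr.
  apply: lee_poweR => //; apply: ae_subset_integral => //.
    by apply: measurableI => //; exact: mlev.
  by apply: aeW => x [].
apply: (@le_trans _ _ (2%:E * ((c / 2)%:E *
    (\int[mu]_(x in setT `&` [set x | (c / 2)%:E < `|h1 x|]) (v x)%:E) `^ q^-1))); last first.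
  by apply: lee_wpmul2l => //; rewrite leeDl// mule_ge0 ?poweR_ge0// lee_fin.
rewrite muleA -EFinM [(2 * _)%R]mulrC divfK//.
apply: lee_wpmul2l; first by rewrite lee_fin ltW.
apply: lee_poweR => //; apply: ae_subset_integral => //.
- by apply: measurableI => //; exact: mlev.
- by apply: measurableI => //; exact: mlev.
apply: filterS hle => x hx [Bx] /= cx; split=> //.
rewrite ltNge; apply/negP => h1c; move: cx; apply/negP; rewrite -leNgt.
apply: (le_trans hx); apply: (@le_trans _ _ ((c / 2)%:E + (c / 2)%:E)).
  by apply: leeD => //; apply: (le_trans (h2k x Bx)); rewrite lee_fin ltW.
by rewrite -EFinD -splitr.
Qed.

End split_norms.

Local Close Scope ereal_scope.

(** * Boundedness on Morrey spaces *)

Theorem theorem1p2 (R : realType) (n : nat) (alpha p q s : R)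
    (w1 w2 : Rn R n -> R) (S : @operator R n) (psi1 psi2 : Rn R n -> R -> R)
    (halpha : 0 < alpha < n%:R)
    (hp : 1 <= p < n%:R / alpha)
    (hq : q^-1 = p^-1 - alpha / n%:R)
    (hs1 : 1 < p -> 1 <= s < p)
    (hs2 : p = 1 -> s = 1)
    (hw1 : weight w1) (hw2 : weight w2)
    (hA12 : Apq (p / s) (q / s) (wpow w1 s) (wpow w2 s))
    (hA2 : Apq (p / s) (q / s) (wpow w2 s) (wpow w2 s))
    (hS : sublinear S)
    (hsize : size_condition alpha s S)
    (hpsi1 : forall a r, 0 < r -> 0 < psi1 a r)
    (hpsi2 : forall a r, 0 < r -> 0 < psi2 a r)
    (hpsi : psi_condition p q w1 w2 psi1 psi2) :
  (1 < p ->
     bounded_op S (Lnrm p (wpow w1 p) setT) (Lnrm q (wpow w2 q) setT) ->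
     bounded_op S (morrey_nrm p (wpow w1 p) psi1)
                  (morrey_nrm q (wpow w2 q) psi2)) /\
  (p = 1 ->
     bounded_op S (Lnrm 1 w1 setT) (WLnrm q (wpow w2 q) setT) ->
     bounded_op S (morrey_nrm 1 w1 psi1)
                  (weak_morrey_nrm q (wpow w2 q) psi2)).
Proof.
have /andP[alpha0 alphan] := halpha; have /andP[p1 pn] := hp.
have nR0 : 0 < n%:R :> R by rewrite (lt_trans alpha0).
have n0 : (0 < n)%N by rewrite -(ltr0n R).
have p0 : 0 < p by rewrite (lt_le_trans ltr01).
have qV0 : 0 < q^-1.
  rewrite hq subr_gt0 ltr_pdivrMr// mulrC ltr_pdivlMr//.
  by move: pn; rewrite ltr_pdivlMr// mulrC.
have q0 : 0 < q by rewrite -invr_gt0.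
have pq : p < q.
  by rewrite -ltf_pV2 ?posrE// hq ltrBlDr ltrDl divr_gt0.
have /andP[s1 sp] : 1 <= s <= p.
  move: p1; rewrite le_eqVlt => /predU1P[p1|p1].
    by rewrite (hs2 (esym p1)) -p1 lexx.
  by have /andP[-> /ltW] := hs1 p1.
have s0 : 0 < s by rewrite (lt_le_trans ltr01).
have Hw1 : ae_positive w1 by case: hw1.
have Hw2 : ae_positive w2 by case: hw2.
have [C C0 HC] := Apq_testing Hw1 Hw2 s0 sp q0 hA12.
have [C' C'0 HC'] := Apq_testing Hw2 Hw2 s0 sp q0 hA2.
have [D D0 HD] := testing_doubling Hw2 s0 sp pq C'0 HC'.
have [mv v0 _] := ae_positive_wpow q Hw2.
pose u a t := fine ((wmeas (wpow w2 q) (Ball a t) `^ q^-1)%E).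
have uE a t : 0 < t -> (wmeas (wpow w2 q) (Ball a t) `^ q^-1)%E = (u a t)%:E.
  move=> t0; rewrite /u fineK// ge0_fin_numE ?poweR_ge0// poweR_lty//.
  exact: testing_wmeas_fin Hw1 p0 q0 s0 HC t0.
have u0 a t : 0 < t -> 0 < u a t.
  move=> t0; rewrite -lte_fin -uE//; apply: poweR_gt0.
  by apply: wmeas_Ball_gt0 => //; exact: ae_positive_wpow.
have umon a t t' : 0 < t -> t <= t' -> u a t <= u a t'.
  move=> t0 tt'; rewrite -lee_fin -!uE//; last exact: lt_le_trans tt'.
  apply: lee_poweR; first exact: ltW.
    by apply: integral_ge0 => x _; rewrite lee_fin.
  exact: le_wmeas_Ball.
have udbl a t : 0 < t -> u a (2 * t) <= D * u a t.
  by move=> t0; rewrite -lee_fin EFinM -!uE ?mulr_gt0//; exact: HD.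
have mB a r : measurable (Ball a r : set (Rn R n)) := measurable_Ball a r.
split=> [p1' Hb|pE Hb].
  refine (@bounded_morrey R n alpha p q s w1 w2 psi1 psi2 u D C Hw1 p0 s0 n0 hq
    D0 C0 HC uE u0 umon udbl hpsi1 hpsi2 hpsi S (Lnrm q (wpow w2 q))
    (2 * 2 `^ q^-1) hS hsize _ _ Hb).
    by rewrite mulr_gt0// powR_gt0.
  move=> a r h h1 h2 k r0 mh mh1 hle k0 h2k.
  rewrite [(k * _)%:E]EFinM -(uE a _ r0).
  exact: (integral_powR_split (mB a r) q0 mh mh1 mv v0 k0 hle h2k).
have w1E : wpow w1 p = w1.
  by apply/funext => x; rewrite /wpow pE powRr1//; case: hw1.
have -> : morrey_nrm 1 w1 psi1 = morrey_nrm p (wpow w1 p) psi1 by rewrite w1E pE.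
refine (@bounded_morrey R n alpha p q s w1 w2 psi1 psi2 u D C Hw1 p0 s0 n0 hq
  D0 C0 HC uE u0 umon udbl hpsi1 hpsi2 hpsi S (WLnrm q (wpow w2 q))
  2 hS hsize _ _ _) => //.
  move=> a r h h1 h2 k r0 mh mh1 hle k0 h2k.
  apply: ge_ereal_sup => _ [c /= c0 <-].
  have := weak_level_split (mB a r) q0 mh mh1 mv v0 k0 c0 hle h2k.
  move=> /le_trans; apply; apply: lee_wpmul2l => //.
  rewrite [(k * _)%:E]EFinM -(uE a _ r0); apply: leeD => //.
  by apply: ereal_sup_ubound; exists (c / 2) => //=; rewrite divr_gt0.
by rewrite w1E pE.
Qed.
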